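(* Let $t\in(-1,0)$ and let $\mu$ be a partition. Define real coefficients $\xi_{\lambda/\mu}(t)$, where $\lambda$ ranges over the partitions with $|\lambda|=|\mu|+2$, by the expansion $$ \bigl((1-t^2)p_2\bigr)\cdot\widetilde Q_\mu(\,;t)=\sum_{\lambda:\,|\lambda|=|\mu|+2}\xi_{\lambda/\mu}(t)\,\widetilde Q_\lambda(\,;t) $$ in the algebra $\mathrm{Sym}$ of symmetric functions. Then $\xi_{\lambda/\mu}(t)=0$ unless $\mu\nearrow\!\nearrow\lambda$. Suppose now that $\mu\nearrow\!\nearrow\lambda$ and set $\theta=\lambda\setminus\mu$. Then: (1) if $\theta$ lies in a single column, with number $k$, then $$\xi_{\lambda/\mu}(t)=(1-t^{m_{k-1}(\mu)})(1-t^{m_{k-1}(\mu)-1});$$ (2) if $\theta$ lies in two consecutive columns, with numbers $k$ and $k+1$, then $$\xi_{\lambda/\mu}(t)=(-t)^{m_k(\mu)}(1+t)(1-t^{m_{k-1}(\mu)}).$$ Here for $k=1$ one uses the convention $m_0(\mu)=+\infty$, i.e. $t^{m_{0}(\mu)}=t^{m_{0}(\mu)-1}=0$.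
   Context: Partitions are identified with Young diagrams. For a partition $\lambda=(\lambda_1\ge\lambda_2\ge\cdots)$: $|\lambda|=\sum_i\lambda_i$, $\ell(\lambda)$ is the number of nonzero parts, $n(\lambda)=\sum_{i\ge1}(i-1)\lambda_i$, and $m_i(\lambda)=\#\{j\ge 1:\lambda_j=i\}$ for $i\ge1$. $\mathrm{Sym}$ is the graded $\mathbb{R}$-algebra of symmetric functions, freely generated by the power sums $p_1,p_2,\dots$. The Hall–Littlewood functions $P_\lambda(\,;t)$ form a linear basis of $\mathrm{Sym}$; in $N\ge\ell(\lambda)$ variables $$P_\lambda(x_1,\dots,x_N;t)=\frac1{v_\lambda(t)}\sum_{w\in S_N}w\Bigl(x_1^{\lambda_1}\cdots x_N^{\lambda_N}\prod_{i<j}\frac{x_i-tx_j}{x_i-x_j}\Bigr),$$ where $v_\lambda(t)=\prod_{i\ge0}\prod_{j=1}^{m_i}\frac{1-t^j}{1-t}$ with $m_0=N-\ell(\lambda)$ and $m_i=m_i(\lambda)$ for $i\ge1$. Further $$Q_\lambda(\,;t)=b_\lambda(t)P_\lambda(\,;t),\quad b_\lambda(t)=\prod_{i\ge1}\prod_{j=1}^{m_i(\lambda)}(1-t^j),\qquad \widetilde Q_\lambda(\,;t)=(-1)^{n(\lambda)}Q_\lambda(\,;t).$$ For partitions with $|\lambda|=|\mu|+2$, write $\mu\nearrow\!\nearrow\lambda$ if $\mu\subset\lambda$ and the two boxes of the skew diagram $\lambda\setminus\mu$ either lie in a single column or lie in two consecutive columns (possibly in different rows). *)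

(* Defs.v *)
From HB Require Import structures.
From mathcomp Require Import all_boot all_order all_algebra all_fingroup.
From mathcomp Require Import finmap monalg mpoly.
From mathcomp Require Import boolp classical_sets fsbigop reals.

Set Implicit Arguments.
Unset Strict Implicit.
Unset Printing Implicit Defensive.

Import GRing.Theory.

Local Open Scope ring_scope.

(* A partition is the weakly decreasing sequence of its nonzero parts; the part
   lambda_(i+1) is [part la i], which is 0 for i >= l(lambda) = [size la]. *)
Record intpart := IntPart {
  parts :> seq nat;
  partsP : sorted geq parts && (0%N \notin parts) }.

HB.instance Definition _ := [isSub for parts].
HB.instance Definition _ := [Choice of intpart by <:].

Definition weight (la : intpart) : nat := sumn la.

Definition part (la : intpart) (i : nat) : nat := nth 0%N la i.

(* n(lambda), with rows numbered from 0 *)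
Definition nstat (la : intpart) : nat := (\sum_(i < size la) i * part la i)%N.

(* m_i(lambda) for i >= 1; the value at i = 0 is never used *)
Definition mpart (la : intpart) (i : nat) : nat := count_mem i (parts la).

(* SymF is the free commutative algebra on p_1, p_2, ...: the i-th variable of
   {cmonom nat} (i >= 0) stands for p_(i+1). *)
Definition SymF (R : realType) := {malg R[{cmonom nat}]}.

HB.instance Definition _ (R : realType) := GRing.ComNzRing.on (SymF R).
HB.instance Definition _ (R : realType) := GRing.ComAlgebra.on (SymF R).

(* p_k, for k >= 1 *)
Definition psum (R : realType) (k : nat) : SymF R := << ucm k.-1 >>.

Section Variables.
Variables (R : realType) (N : nat).

(* The notation {mpoly R[N]} is ambiguous between mpoly and monalg. *)
Definition XPol := mpoly.mpoly N R.

HB.instance Definition _ := GRing.IntegralDomain.on XPol.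

Definition polyvar (i : 'I_N) : XPol := mpolyX R (mnm1 i).

(* The specialization p_k |-> x_1^k + ... + x_N^k of SymF to N variables *)
Definition spec : SymF R -> XPol :=
  monalg.mmap (@mpolyC N R)
    (fun m : {cmonom nat} =>
       \prod_(i <- finsupp (cmonom_val m))
          (\sum_(j < N) polyvar j ^+ i.+1) ^+ cmonom_val m i).

Definition XFrac := {fraction XPol}.

Definition ratC (c : R) : XFrac := tofrac (mpolyC N c : XPol).

Definition ratX (i : 'I_N) : XFrac := tofrac (polyvar i).

Definition vHL (t : R) (la : intpart) : R :=
  (\prod_(1 <= j < (N - size la).+1) ((1 - t ^+ j) / (1 - t))) *
  \prod_(1 <= i < (weight la).+1)
     \prod_(1 <= j < (mpart la i).+1) ((1 - t ^+ j) / (1 - t)).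

(* The N-variable Hall-Littlewood polynomial, meaningful for size la <= N;
   the permutation w acts by x_i |-> x_(w i). *)
Definition HLrat (t : R) (la : intpart) : XFrac :=
  ratC (vHL t la)^-1 *
  \sum_(w : {perm 'I_N})
     ((\prod_(i < N) ratX (w i) ^+ part la i) *
      \prod_(i < N) \prod_(j < N | (i < j)%N)
         ((ratX (w i) - ratC t * ratX (w j)) / (ratX (w i) - ratX (w j)))).

End Variables.

(* P_lambda( ;t) is the element of SymF whose specialization to N variables is
   the above polynomial for every N >= l(lambda). *)
Definition HL_P (R : realType) (t : R) (la : intpart) : SymF R :=
  xget 0 [set f : SymF R | forall N : nat, (size la <= N)%N ->
                            tofrac (spec N f) = HLrat N t la]%classic.

Definition bHL (R : realType) (t : R) (la : intpart) : R :=
  \prod_(1 <= i < (weight la).+1) \prod_(1 <= j < (mpart la i).+1) (1 - t ^+ j).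

Definition HL_Q (R : realType) (t : R) (la : intpart) : SymF R :=
  bHL t la *: HL_P t la.

Definition HL_Qt (R : realType) (t : R) (la : intpart) : SymF R :=
  (-1) ^+ nstat la *: HL_Q t la.

Definition subdiagram (mu la : intpart) : Prop :=
  forall i : nat, (part mu i <= part la i)%N.

(* The set of numbers (from 1) of the columns which meet the skew diagram
   lambda \ mu; row i of it has its boxes in columns mu_i + 1, ..., la_i. *)
Definition skew_columns (la mu : intpart) : set nat :=
  [set j : nat | exists i : nat, (part mu i < j <= part la i)%N]%classic.

Definition in_single_column (la mu : intpart) (k : nat) : Prop :=
  skew_columns la mu = [set k]%classic.

Definition in_two_columns (la mu : intpart) (k : nat) : Prop :=
  skew_columns la mu = [set k; k.+1]%classic.

Definition two_box_arrow (mu la : intpart) : Prop :=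
  [/\ weight la = (weight mu + 2)%N, subdiagram mu la &
      exists k : nat, in_single_column la mu k \/ in_two_columns la mu k].

(* m_i(mu) with the convention m_0 = +oo, encoded as None, and t^(+oo) = 0 *)
Definition mult_ext (mu : intpart) (i : nat) : option nat :=
  if i == 0%N then None else Some (mpart mu i).

Definition pow_ext (R : realType) (t : R) (e : option nat) : R :=
  if e is Some n then t ^+ n else 0.

(* xi gives the coefficients of (1 - t^2) p_2 Qt_mu in the Qt_lambda. *)
Definition p2_expansion (R : realType) (t : R) (mu : intpart)
    (xi : intpart -> R) : Prop :=
  ((1 - t ^+ 2) *: psum R 2) * HL_Qt t mu =
  \sum_(la \in [set la : intpart | weight la = (weight mu + 2)%N]%classic)
     xi la *: HL_Qt t la.

(* Main.v *)
(* In N variables p_2 is symmetric, so p_2 Q_mu is obtained by adding 2 to each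
   part of mu in turn, the parts 0 being handled by p_2 itself. The resulting
   compositions are straightened with two relations between adjacent parts,
   Q_(s,s+1) = t Q_(s+1,s) and
   Q_(s,s+2) = t Q_(s+2,s) - (1 - t) Q_(s+1,s+1),
   and summing the geometric series over each block of equal parts gives
     (1 - t^2) p_2 Q_mu =
       sum_s t^(m_(s+1)) (1 + t) (1 - t^(m_s)) Q_(mu: s -> s+2)
           - (1 - t^(m_s)) (1 - t^(m_s - 1)) Q_(mu: s,s -> s+1,s+1).
   The sign (-1)^n(la) turns this into the stated coefficients. To lift the
   identity to Sym, the Pieri rule for the elementary functions and Newton's
   identities expand every product of power sums in the Q_la with coefficients
   independent of N; as the power sums are algebraically independent, this
   expansion is invertible, so that the Q_la exist in Sym and form a basis. *)
Require Import Defs.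
From HB Require Import structures.
From mathcomp Require Import all_boot all_order all_algebra all_fingroup.
From mathcomp Require Import finmap monalg mpoly.
From mathcomp Require Import boolp classical_sets cardinality fsbigop reals.
From mathcomp Require Import zify ring lra.

Set Implicit Arguments.
Unset Strict Implicit.
Unset Printing Implicit Defensive.

Import Order.TTheory GRing.Theory Num.Theory.

Local Open Scope ring_scope.

(** * Hall-Littlewood sums over a finite set of variables *)

(** The definition symmetrizes over all permutations of N variables, a form from which no part can
    be split off. [hl] instead distributes the parts one at a time over an arbitrary set X of
    variables, and needs no parts 0. A relation that holds for every X, with coefficients free of X,
    survives the prefixing of a part, so the inductions run on the list of parts. Leaving out the
    zeros makes the coefficients independent of N, and it is the source of the convention t^(m_0) =
    0: the term s = 0 starts at the empty partition, where (1 - t^2) p_2 = (1 + t) Q_(2) - Q_(1,1).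
    The bound on t gives 1 - t^j <> 0 for j > 0, so b and v can be inverted. Since P is chosen by
    [xget], nothing is known about it until an element with the right specializations has been
    produced and shown to be unique. Diagrams are compared through column lengths: adding boxes is
    additive there, whereas the rows get sorted anew. *)

Section HallLittlewoodField.
Variables (F : fieldType) (I : finType) (x : I -> F) (t : F).

Implicit Types X : {set I}.

Definition hlfactor (i j : I) : F := (x i - t * x j) / (x i - x j).

(* Q_l(x_i, i in X; t), as the sum over the injective choices of variables
   carrying the parts of l; the parts beyond [size l] need not be symmetrized,
   and the value is 0 when [size l > #|X|]. *)
Fixpoint hl (l : seq nat) (X : {set I}) : F :=
  if l is a :: l' then
    (1 - t) * \sum_(i in X)
      x i ^+ a * (\prod_(j in X :\ i) hlfactor i j) * hl l' (X :\ i)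
  else 1.

Definition elempoly (X : {set I}) : {poly F} := \prod_(j in X) (1 + x j *: 'X).

Definition elem (k : nat) (X : {set I}) : F := (elempoly X)`_k.

Definition power (r : nat) (X : {set I}) : F := \sum_(i in X) x i ^+ r.

Lemma hl_nil X : hl [::] X = 1.
Proof. by []. Qed.

Lemma hl_cons a l X :
  hl (a :: l) X = (1 - t) * \sum_(i in X)
      x i ^+ a * (\prod_(j in X :\ i) hlfactor i j) * hl l (X :\ i).
Proof. by []. Qed.

Lemma elempolyD1 X i : i \in X ->
  elempoly X = (1 + x i *: 'X) * elempoly (X :\ i).
Proof. exact: big_setD1. Qed.

Lemma elem0 X : elem 0 X = 1.
Proof.
rewrite /elem -horner_coef0 /elempoly horner_prod big1 // => i _.
by rewrite hornerD hornerC hornerZ hornerX mulr0 addr0.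
Qed.

Lemma elemS X i k : i \in X ->
  elem k.+1 X = elem k.+1 (X :\ i) + x i * elem k (X :\ i).
Proof.
move=> iX; rewrite /elem (elempolyD1 iX) mulrDl mul1r coefD.
by rewrite -scalerAl coefZ coefXM.
Qed.

(** The scalar [c] lets one bound serve both for [elempoly] ([c = 1]) and for its dilation by t. *)
Lemma size_elempoly X (c : F) :
  (size (\prod_(j in X) (1 + (c * x j) *: 'X : {poly F}))%R <= #|X|.+1)%N.
Proof.
rewrite -sum1_card; apply: (big_rec2 (fun (p : {poly F}) n => (size p <= n.+1)%N)).
  by rewrite size_poly1.
move=> i n p _ hp; apply: leq_trans (size_polyMleq _ _) _.
have : (size (1 + (c * x i) *: 'X : {poly F})%R <= 2)%N.
  rewrite (leq_trans (size_polyD _ _)) // geq_max size_poly1 /=.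
  by rewrite (leq_trans (size_scale_leq _ _)) // size_polyX.
lia.
Qed.

Lemma elempolyE X : elempoly X = \prod_(j in X) (1 + (1 * x j) *: 'X).
Proof. by apply: eq_bigr => i _; rewrite mul1r. Qed.

Lemma elem_gt X k : (#|X| < k)%N -> elem k X = 0.
Proof.
move=> h; rewrite /elem nth_default // elempolyE.
exact: leq_trans (size_elempoly _ _) _.
Qed.

Lemma elem_top X : elem #|X| X = \prod_(i in X) x i.
Proof.
move: {2}#|X| (erefl #|X|) => n; elim: n X => [|n IH] X cX.
  by rewrite cX elem0 (cards0_eq cX) big_set0.
have /card_gt0P[i iX] : (0 < #|X|)%N by rewrite cX.
have cXi : #|X :\ i| = n by move: cX; rewrite (cardsD1 i) iX => -[].
have := IH _ cXi; rewrite cXi => e.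
by rewrite cX (elemS _ iX) elem_gt ?cXi // add0r e [RHS](big_setD1 i iX).
Qed.

Hypothesis x_inj : injective x.
Hypothesis x_neq0 : forall i, x i != 0.

Let dX i j : i != j -> x i - x j != 0.
Proof. by move=> ne; rewrite subr_eq0; apply: contra ne => /eqP/x_inj->. Qed.

(* Both sides have degree at most #|X| and agree at 0 and at the points
   - 1 / x i, i \in X. *)
Lemma elempoly_lagrange X :
  (1 - t) *: ('X * \sum_(i in X)
      (x i * \prod_(j in X :\ i) hlfactor i j) *: elempoly (X :\ i)) =
  elempoly X - \prod_(j in X) (1 + (t * x j) *: 'X).
Proof.
apply/eqP; rewrite -subr_eq0; set D := (D in D == 0); apply: contraT => D0.
pose rs := 0 :: [seq - (x i)^-1 | i <- enum X].
have rsU : uniq rs.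
  rewrite /= map_inj_uniq ?enum_uniq ?andbT.
    apply/mapP => -[i _] /esym/eqP.
    by rewrite oppr_eq0 invr_eq0 (negbTE (x_neq0 i)).
  by move=> i j /oppr_inj/invr_inj/x_inj.
have sD : (size D <= #|X|.+1)%N.
  rewrite /D (leq_trans (size_polyD _ _)) // geq_max; apply/andP; split; last first.
    rewrite size_polyN (leq_trans (size_polyD _ _)) // geq_max size_polyN.
    by rewrite elempolyE !size_elempoly.
  apply: leq_trans (size_scale_leq _ _) _.
  apply: leq_trans (size_polyMleq _ _) _; rewrite size_polyX /= ltnS.
  apply: leq_trans (size_sum _ _ _) _; apply/bigmax_leqP => i iX.
  apply: leq_trans (size_scale_leq _ _) _; rewrite elempolyE.
  by apply: leq_trans (size_elempoly _ _) _; rewrite (cardsD1 i X) iX.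
have : (size rs < size D)%N.
  apply: max_poly_roots D0 _ rsU; apply/allP => y.
  rewrite inE => /orP[/eqP->|].
    rewrite /root /D /elempoly !hornerD !hornerN hornerZ hornerM hornerX mul0r mulr0.
    by rewrite hornerD hornerN !horner_prod !big1 ?subrr // => i _;
    rewrite hornerD hornerC hornerZ hornerX mulr0 addr0.
  case/mapP => i; rewrite mem_enum => iX -> {y}.
  (* At - 1 / x_i only the term k = i survives: for every other k, [elempoly (X :\ k)] contains the
     factor 1 + x_i 'X. *)
  have S : (\sum_(k in X) (x k * \prod_(j in X :\ k) hlfactor k j) *:
      elempoly (X :\ k)).[- (x i)^-1] =
      x i * (\prod_(j in X :\ i) hlfactor i j * (elempoly (X :\ i)).[- (x i)^-1]).
    rewrite horner_sum (big_setD1 i) //= hornerZ [Y in _ + Y]big1 ?addr0 ?mulrA // => j.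
    rewrite !inE => /andP[ji jX]; rewrite hornerZ /elempoly horner_prod.
    rewrite [Y in _ * Y = _](big_setD1 i) /=; last by rewrite !inE eq_sym ji.
    by rewrite hornerD hornerC hornerZ hornerX mulrN mulfV // subrr mul0r mulr0.
  rewrite /root /D hornerD hornerN hornerZ hornerM hornerX S hornerD hornerN.
  rewrite [elempoly X](big_setD1 i iX) /= [\prod_(j in X) _](big_setD1 i iX) /=.
  rewrite !hornerM !hornerD !hornerC !hornerZ hornerX.
  rewrite !mulrN mulfV // subrr mul0r sub0r -mulrA mulfV // mulr1 opprK.
  rewrite mulNr [_^-1 * _]mulrA mulVf // mul1r mulrN addrC subr_eq0.
  apply/eqP; congr (_ * _).
  rewrite /elempoly !horner_prod -big_split /=.
  apply: eq_bigr => j; rewrite !inE eq_sym => /andP[/dX h _].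
  have h' := x_neq0 i; rewrite /hlfactor !(hornerD, hornerC, hornerZ, hornerX).
  by field; rewrite h h'.
by rewrite /= size_map -cardE ltnNge sD.
Qed.

Lemma elempoly_scaleE X k :
  (\prod_(j in X) (1 + (t * x j) *: 'X : {poly F}))`_k = t ^+ k * elem k X.
Proof.
move: {2}#|X| (erefl #|X|) k => n; elim: n X => [|n IH] X cX k.
  rewrite (cards0_eq cX) /elem /elempoly !big_set0 coef1.
  by case: k => [|k]; rewrite ?expr0 ?mulr1 ?mulr0.
have /card_gt0P[i iX] : (0 < #|X|)%N by rewrite cX.
have cXi : #|X :\ i| = n by move: cX; rewrite (cardsD1 i) iX => -[].
have -> : \prod_(j in X) (1 + (t * x j) *: 'X : {poly F}) =
   (1 + (t * x i) *: 'X) * \prod_(j in X :\ i) (1 + (t * x j) *: 'X : {poly F}).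
  exact: big_setD1.
rewrite mulrDl mul1r coefD -scalerAl coefZ coefXM IH //.
case: k => [|k]; first by rewrite !elem0 mulr0 addr0.
by rewrite IH // (elemS _ iX) /= exprS; ring.
Qed.

(** Comparison of the coefficients of degree k + 1 in [elempoly_lagrange]. *)
Lemma hl_elem_sum X k :
  (1 - t) * \sum_(i in X) x i * (\prod_(j in X :\ i) hlfactor i j) * elem k (X :\ i)
  = (1 - t ^+ k.+1) * elem k.+1 X.
Proof.
have := congr1 (fun p : {poly F} => p`_k.+1) (elempoly_lagrange X).
rewrite /= coefZ coefXM /= coefB elempoly_scaleE coef_sum.
rewrite -/(elem _ _) => E; rewrite [RHS]mulrBl mul1r -E; congr (_ * _); apply: eq_bigr => i _.
by rewrite coefZ.
Qed.

Lemma hl_ones k X :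
  hl (nseq k 1%N) X = (\prod_(1 <= j < k.+1) (1 - t ^+ j)) * elem k X.
Proof.
elim: k X => [|k IH] X; first by rewrite big_geq // elem0 mulr1.
rewrite /= big_nat_recr //= -mulrA -hl_elem_sum mulrCA; congr (_ * _).
by rewrite mulr_sumr; apply: eq_bigr => i _; rewrite IH expr1; ring.
Qed.

(** The top case of [hl_elem_sum]: there x_i e_k(X \ i) is the product of all variables whatever i
    is, and this product can be cancelled. *)
Lemma hl_factor_sum X :
  (1 - t) * \sum_(i in X) \prod_(j in X :\ i) hlfactor i j = 1 - t ^+ #|X|.
Proof.
have [->|[i0 i0X]] := set_0Vmem X; first by rewrite big_set0 cards0 mulr0 subrr.
have cX : #|X| = #|X :\ i0|.+1 by rewrite (cardsD1 i0) i0X.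
have := hl_elem_sum X #|X :\ i0|; rewrite -cX elem_top => E.
have px : \prod_(i in X) x i != 0 by apply/prodf_neq0.
apply: (mulIf px); rewrite -E -mulrA mulr_suml; congr (_ * _).
apply: eq_bigr => i iX.
have cXi : #|X :\ i0| = #|X :\ i|.
  by apply/eqP; rewrite -eqSS -cX (cardsD1 i X) iX.
rewrite cXi elem_top (big_setD1 i iX) /=.
by ring.
Qed.

(** After the parts of l exactly M variables are left, and [hl_factor_sum] evaluates the sums over
    them one by one. The constant is the m_0 factor of v, up to powers of 1 - t. *)
Lemma hl_pad0 l M X : #|X| = (size l + M)%N ->
  hl (l ++ nseq M 0%N) X = (\prod_(1 <= j < M.+1) (1 - t ^+ j)) * hl l X.
Proof.
elim: l X => [|a l IH] X cX.
  rewrite add0n in cX.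
  elim: M X cX => [|M IH] X cX /=; first by rewrite big_geq ?mulr1.
  have E := hl_factor_sum X; rewrite cX in E.
  rewrite big_nat_recr //= mulr1 -E mulrCA; congr (_ * _).
  rewrite mulr_sumr; apply: eq_bigr => i iX; rewrite IH /=; first by ring.
  by move: cX; rewrite (cardsD1 i) iX => -[].
rewrite /= mulrCA; congr (_ * _); rewrite mulr_sumr; apply: eq_bigr => i iX.
rewrite IH; first by ring.
by move: cX; rewrite (cardsD1 i) iX => -[].
Qed.

(** If x_i carries the head, then p_r(X) = x_i^r + p_r(X \ i): the factor either raises the head or
    passes on to the tail. [elem_hl_cons] does the same for e_(k+1). *)
Lemma power_hl_cons r a l X :
  power r X * hl (a :: l) X = hl ((a + r)%N :: l) X +
  (1 - t) * \sum_(i in X) x i ^+ a * (\prod_(j in X :\ i) hlfactor i j) *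
     (power r (X :\ i) * hl l (X :\ i)).
Proof.
rewrite /= mulrCA -mulrDr; congr (_ * _).
rewrite mulr_sumr -big_split /=; apply: eq_bigr => i iX.
have -> : power r X = x i ^+ r + power r (X :\ i).
  exact: big_setD1.
by rewrite exprD; ring.
Qed.

Lemma elem_hl_cons k a l X :
  elem k.+1 X * hl (a :: l) X =
  (1 - t) * (\sum_(i in X) x i ^+ a * (\prod_(j in X :\ i) hlfactor i j) *
     (elem k.+1 (X :\ i) * hl l (X :\ i))) +
  (1 - t) * (\sum_(i in X) x i ^+ a.+1 * (\prod_(j in X :\ i) hlfactor i j) *
     (elem k (X :\ i) * hl l (X :\ i))).
Proof.
rewrite /= mulrCA -mulrDr; congr (_ * _).
rewrite mulr_sumr -big_split /=; apply: eq_bigr => i iX.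
by rewrite (elemS _ iX) exprSr; ring.
Qed.

(* [hook m 0] is p_(m+1) and [hook 0 r] is (r+1) e_(r+1); [hookS] then
   telescopes to Newton's identities. *)
Definition hook m r X : F := \sum_(i in X) x i ^+ m.+1 * elem r (X :\ i).

Lemma hook0 m X : hook m 0 X = power m.+1 X.
Proof. by apply: eq_bigr => i _; rewrite elem0 mulr1. Qed.

Lemma hookS m r X :
  hook m r.+1 X = power m.+1 X * elem r.+1 X - hook m.+1 r X.
Proof.
rewrite /power mulr_suml -sumrB; apply: eq_bigr => i iX.
by rewrite (elemS _ iX) [x i ^+ m.+2]exprSr; ring.
Qed.

(** Each monomial of e_(r+1) arises r + 1 times, once for each of its variables; the derivative of
    [elempoly] does the counting. *)
Lemma hook_elem r X : hook 0 r X = r.+1%:R * elem r.+1 X.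
Proof.
rewrite /elem mulr_natl -coef_deriv.
have -> : (elempoly X)^`() = \sum_(i in X) x i *: elempoly (X :\ i).
  move: {2}#|X| (erefl #|X|) => n; elim: n X => [|n IH] X cX.
    by rewrite (cards0_eq cX) /elempoly !big_set0 derivC.
  have /card_gt0P[i iX] : (0 < #|X|)%N by rewrite cX.
  have cXi : #|X :\ i| = n by move: cX; rewrite (cardsD1 i) iX => -[].
  rewrite {1}(elempolyD1 iX) derivM IH // derivD derivC add0r derivZ derivX.
  rewrite [RHS](bigD1 i iX) /= -scalerAl mul1r; congr (_ + _).
  rewrite mulr_sumr; apply: eq_big => [j|j]; rewrite !inE 1?andbC // => /andP[ji jX].
  have iXj : i \in X :\ j by rewrite !inE eq_sym jX.
  rewrite (elempolyD1 iXj) scalerAr; congr (_ * (_ *: elempoly _)).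
  by apply/setP => k; rewrite !inE andbCA.
by rewrite coef_sum; apply: eq_bigr => i _; rewrite coefZ expr1.
Qed.

(** * Straightening relations between the first two parts *)

Hypothesis two_neq0 : 2%:R != 0 :> F.

Lemma hl_cons2 a b l X : hl (a :: b :: l) X =
  (1 - t) ^+ 2 * \sum_(i in X) \sum_(j in X :\ i)
    (x i ^+ a * x j ^+ b * hlfactor i j) *
    (\prod_(k in X :\ i :\ j) (hlfactor i k * hlfactor j k) * hl l (X :\ i :\ j)).
Proof.
rewrite /= expr2 -mulrA; congr (_ * _); rewrite mulr_sumr; apply: eq_bigr => i iX.
rewrite mulrCA; congr (_ * _); rewrite mulr_sumr; apply: eq_bigr => j jX.
rewrite [\prod_(k in _) (hlfactor i k * _)]big_split /=.
rewrite [in LHS](big_setD1 j jX) /=.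
by ring.
Qed.

(** Exchanging i and j gives S + S = 0; dividing by 2 avoids choosing an order on [I]. *)
Lemma antisym_sum0 X (f W : I -> I -> F) :
  (forall i j, i != j -> f i j + f j i = 0) -> (forall i j, W i j = W j i) ->
  \sum_(i in X) \sum_(j in X :\ i) f i j * W i j = 0.
Proof.
move=> fA WS; set S := (S in S = 0).
suff: S + S = 0 by rewrite -mulr2n -mulr_natl => /eqP; rewrite mulf_eq0 (negbTE two_neq0) => /eqP.
rewrite {2}/S (exchange_big_dep (mem X)) /=; last first.
  by move=> i j _; rewrite !inE => /andP[].
rewrite -big_split /= big1 // => i iX.
rewrite [X in _ + X](eq_bigl (fun j => j \in X :\ i)); last first.
  by move=> j; rewrite !inE eq_sym iX andbT andbC.
rewrite -big_split /= big1 // => j; rewrite !inE => /andP[ji _].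
by rewrite (WS j i) -mulrDl fA ?mul0r // eq_sym.
Qed.

(* Pairs the term in which the first two parts are carried by (x_i, x_j) with
   the one in which they are carried by (x_j, x_i). *)
Lemma hl_lincomb2 (s : seq (F * (nat * nat))) l X :
  (forall y z : F, y != z ->
    \sum_(c <- s) c.1 * (y ^+ c.2.1 * z ^+ c.2.2 * (y - t * z) -
                         z ^+ c.2.1 * y ^+ c.2.2 * (z - t * y)) = 0) ->
  \sum_(c <- s) c.1 * hl (c.2.1 :: c.2.2 :: l) X = 0.
Proof.
move=> H; pose f i j := \sum_(c <- s) c.1 * (x i ^+ c.2.1 * x j ^+ c.2.2 * hlfactor i j).
under eq_bigr => c _ do rewrite hl_cons2 mulrCA.
rewrite -mulr_sumr; apply/eqP; rewrite mulf_eq0; apply/orP; right; apply/eqP.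
pose W i j := \prod_(k in X :\ i :\ j) (hlfactor i k * hlfactor j k) * hl l (X :\ i :\ j).
transitivity (\sum_(i in X) \sum_(j in X :\ i) f i j * W i j).
  under eq_bigr => c _ do rewrite mulr_sumr.
  rewrite exchange_big; apply: eq_bigr => i _ /=.
  under eq_bigr => c _ do rewrite mulr_sumr.
  rewrite exchange_big; apply: eq_bigr => j _ /=.
  by rewrite /f mulr_suml; apply: eq_bigr => c _; rewrite !mulrA.
apply: antisym_sum0 => [i j ij|i j]; last first.
  have e : X :\ i :\ j = X :\ j :\ i by apply/setP => k; rewrite !inE andbCA.
  by rewrite /W e; congr (_ * _); apply: eq_bigr => k _; rewrite mulrC.
have xij := dX ij; have xji : x j - x i != 0 by rewrite -opprB oppr_eq0.
rewrite -(mul0r (x i - x j)^-1) -(H (x i) (x j)); last by rewrite -subr_eq0.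
rewrite mulr_suml -big_split /=; apply: eq_bigr => c _; rewrite /hlfactor.
have -> : (x j - x i)^-1 = - (x i - x j)^-1 by rewrite -invrN opprB.
by ring.
Qed.

(** The monomials combine to (yz)^s (z - ty), whose product with y - tz is symmetric in y and z. *)
Lemma hl_head_swap s l X : hl (s :: s.+1 :: l) X = t * hl (s.+1 :: s :: l) X.
Proof.
have := @hl_lincomb2 [:: (1, (s, s.+1)); (- t, (s.+1, s))] l X _.
rewrite !big_cons !big_nil addr0 mul1r mulNr => H; apply/eqP; rewrite -subr_eq0.
by apply/eqP/H => y z _; rewrite !big_cons !big_nil /= !exprS; ring.
Qed.

(** Here the combination is (yz)^s (y + z)(z - ty), again symmetric after multiplication by y -
    tz. *)
Lemma hl_head_swap2 s l X : hl (s :: s.+2 :: l) X =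
  t * hl (s.+2 :: s :: l) X - (1 - t) * hl (s.+1 :: s.+1 :: l) X.
Proof.
have := @hl_lincomb2 [:: (1, (s, s.+2)); (- t, (s.+2, s)); (1 - t, (s.+1, s.+1))] l X _.
rewrite !big_cons !big_nil addr0 mul1r mulNr => H; apply/eqP; rewrite -subr_eq0 opprB.
rewrite addrC addrAC -addrA addrC -addrA.
by apply/eqP/H => y z _; rewrite !big_cons !big_nil /= !exprS; ring.
Qed.

End HallLittlewoodField.

Arguments hl {F I} x t l X : simpl never.

(** * Multiplication by p_2 *)

Lemma geq_trans : transitive geq.
Proof. by move=> m n p nm mp; apply: leq_trans mp nm. Qed.

Lemma sort_geq_eq (s l : seq nat) : sorted geq l -> perm_eq s l -> sort geq s = l.
Proof.
have geqT : total geq by move=> m n; rewrite /geq /= leq_total.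
move=> sl /(perm_sortP geqT geq_trans) ->; last first.
  by move=> m n; rewrite /geq /= andbC; apply: anti_leq.
exact: sorted_sort geq_trans _ sl.
Qed.

Lemma sorted_geq_cons a (l : seq nat) :
  sorted geq (a :: l) = all (geq a) l && sorted geq l.
Proof. exact: path_sortedE geq_trans _ _. Qed.

Lemma sorted_geq_head a l : all (geq a) l -> sorted geq l -> a \in l ->
  exists l', l = a :: l'.
Proof.
case: l => [//|b l] /= /andP[ba _] sl.
rewrite inE => /orP[/eqP->|al]; first by exists l.
exists l; congr (_ :: _); apply/eqP; rewrite eqn_leq [(b <= a)%N]ba /=.
exact: (allP (order_path_min geq_trans sl)).
Qed.

(** A part s becomes s + 2, or in [up11] two parts s become s + 1. As [rem] leaves l unchanged when
    s is absent, s = 0 creates new parts: zeros are not stored but are always available. *)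
Definition up2 (s : nat) (l : seq nat) : seq nat := sort geq (s.+2 :: rem s l).

Definition up11 (s : nat) (l : seq nat) : seq nat :=
  sort geq [:: s.+1, s.+1 & rem s (rem s l)].

Lemma all_rem (p : pred nat) s l : all p l -> all p (rem s l).
Proof. by move=> /allP h; apply/allP => y /mem_rem/h. Qed.

Lemma sorted_rem s l : sorted geq l -> sorted geq (rem s l).
Proof. exact: (subseq_sorted geq_trans (rem_subseq _ _)). Qed.

Section PowerSum2.
Variables (F : fieldType) (I : finType) (x : I -> F) (t : F).
Hypotheses (x_inj : injective x) (x_neq0 : forall i, x i != 0).
Hypothesis two_neq0 : 2%:R != 0 :> F.

Local Notation hl := (hl x t).

(* [t ^+ m_s(l)] and [t ^+ (m_s(l) - 1)], with m_0 = +oo *)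
Definition tmult (s : nat) (l : seq nat) : F :=
  if s == 0%N then 0 else t ^+ count_mem s l.

Definition tmult1 (s : nat) (l : seq nat) : F :=
  if s == 0%N then 0 else t ^+ (count_mem s l).-1.

Definition coef2 (s : nat) (l : seq nat) : F :=
  t ^+ count_mem s.+1 l * (1 + t) * (1 - tmult s l).

Definition coef11 (s : nat) (l : seq nat) : F :=
  (1 - tmult s l) * (1 - tmult1 s l).

Definition term2 s l X : F :=
  coef2 s l * hl (up2 s l) X - coef11 s l * hl (up11 s l) X.

(** Rests on p_2 = e_1^2 - 2 e_2, Q_(1,1) = (1 - t)(1 - t^2) e_2 and Q_(2) = (1 - t) e_1^2 - (1 -
    t^2) e_2. *)
Lemma power2_base X :
  (1 - t ^+ 2) * power x 2 X = (1 + t) * hl [:: 2] X - hl [:: 1; 1]%N X.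
Proof.
have e1 : power x 1 X = elem x 1 X by rewrite -hook0 hook_elem mul1r.
have -> : power x 2 X = elem x 1 X ^+ 2 - 2%:R * elem x 2 X.
  have := hookS x 0 0 X; rewrite hook_elem hook0 e1 => E.
  by rewrite E; ring.
have -> : hl [:: 1; 1]%N X = (1 - t) * (1 - t ^+ 2) * elem x 2 X.
  rewrite (hl_ones t x_inj x_neq0 2 X); congr (_ * _).
  by rewrite big_ltn // big_ltn // big_geq // mulr1 expr1.
have -> : hl [:: 2] X = (1 - t) * elem x 1 X * elem x 1 X - (1 - t ^+ 2) * elem x 2 X.
  have := hl_elem_sum t x_inj x_neq0 X 0; rewrite expr1 => <-.
  rewrite -(hl_elem_sum t x_inj x_neq0 X 1) -!mulrA -mulrBr hl_cons; congr (_ * _).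
  rewrite mulr_suml -sumrB; apply: eq_bigr => i iX.
  by rewrite (elemS _ _ iX) !elem0 hl_nil; ring.
by ring.
Qed.

Lemma coef2_0 s l : (0 < s)%N -> s \notin l -> coef2 s l = 0.
Proof.
by move=> s0 sl; rewrite /coef2 /tmult gtn_eqF // (count_memPn sl) subrr mulr0.
Qed.

Lemma coef11_0 s l : (0 < s)%N -> s \notin l -> coef11 s l = 0.
Proof.
by move=> s0 sl; rewrite /coef11 /tmult gtn_eqF // (count_memPn sl) subrr mul0r.
Qed.

Lemma coef11_1 s l : (0 < s)%N -> (count_mem s l <= 1)%N -> coef11 s l = 0.
Proof.
move=> s0; rewrite /coef11 /tmult /tmult1 gtn_eqF //.
by case: (count_mem s l) => [|[|//]] _ /=; rewrite subrr ?mulr0 ?mul0r.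
Qed.

(** Carries a straightening relation below the head; the relation is required for all Y because the
    head removes a variable. *)
Lemma hl_cons_ext a l l' c X :
  (forall Y, hl l Y = c * hl l' Y) -> hl (a :: l) X = c * hl (a :: l') X.
Proof.
move=> h; rewrite !hl_cons mulrCA; congr (_ * _); rewrite mulr_sumr.
by apply: eq_bigr => i _; rewrite h; ring.
Qed.

Lemma power2_hl_rec n a l X :
  (forall Y, (1 - t ^+ 2) * power x 2 Y * hl l Y = \sum_(s < n) term2 s l Y) ->
  (1 - t ^+ 2) * power x 2 X * hl (a :: l) X =
  (1 - t ^+ 2) * hl (a.+2 :: l) X +
  \sum_(s < n) (coef2 s l * hl (a :: up2 s l) X - coef11 s l * hl (a :: up11 s l) X).
Proof.
move=> h; rewrite -mulrA power_hl_cons addn2 mulrDr; congr (_ + _).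
rewrite mulrCA mulr_sumr.
under eq_bigr => i _ do rewrite mulrCA [(1 - _) * _]mulrA h mulr_sumr.
rewrite exchange_big mulr_sumr; apply: eq_bigr => s _ /=.
rewrite !hl_cons mulrCA [coef11 _ _ * _]mulrCA -mulrBr; congr (_ * _).
by rewrite 2!mulr_sumr -sumrB; apply: eq_bigr => i _; rewrite /term2; ring.
Qed.

Lemma sort_geq_cons a l : all (geq a) l -> sort geq (a :: l) = a :: sort geq l.
Proof.
move=> la; apply: sort_geq_eq; last first.
  by rewrite perm_cons perm_sym perm_sort.
by rewrite sorted_geq_cons all_sort la sort_sorted // => m n; apply: leq_total.
Qed.

Lemma sort_geq_id l : sorted geq l -> sort geq l = l.
Proof. by move=> sl; apply: sort_geq_eq. Qed.

Lemma sort_geq_perm l1 l2 : perm_eq l1 l2 -> sort geq l1 = sort geq l2.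
Proof.
move=> p; apply: sort_geq_eq.
  by apply: sort_sorted => m n; rewrite /geq /= leq_total.
by rewrite (perm_trans p) // perm_sym perm_sort.
Qed.

Lemma up11_lt s a l : all (geq a) l -> (s < a)%N -> up11 s (a :: l) = a :: up11 s l.
Proof.
move=> la sa; have nas : (a == s) = false by rewrite gtn_eqF.
rewrite -sort_geq_cons; last by rewrite /= /geq /= !sa !all_rem.
apply: sort_geq_perm; rewrite /= nas /= nas.
by rewrite -(perm_catCA [:: a] [:: s.+1; s.+1]).
Qed.

Lemma up2_lt s a l : all (geq a) l -> (s.+1 < a)%N -> up2 s (a :: l) = a :: up2 s l.
Proof.
move=> la sa; have nas : (a == s) = false by rewrite gtn_eqF // ltnW.
rewrite -sort_geq_cons; last by rewrite /= /geq /= sa all_rem.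
apply: sort_geq_perm; rewrite /= nas /=.
by rewrite -(perm_catCA [:: a] [:: s.+2]).
Qed.

Lemma up2_le s l : sorted geq l -> all (geq s.+2) l -> up2 s l = s.+2 :: rem s l.
Proof.
by move=> sl la; rewrite /up2 sort_geq_cons ?all_rem // sort_geq_id ?sorted_rem.
Qed.

Lemma up11_le s l : sorted geq l -> all (geq s.+1) l ->
  up11 s l = [:: s.+1, s.+1 & rem s (rem s l)].
Proof.
move=> sl la; rewrite /up11 !sort_geq_cons ?sort_geq_id ?all_rem ?sorted_rem //.
by rewrite /= /geq /= leqnn !all_rem.
Qed.

(** Only a = s + 1 needs straightening: the new part s + 2 has to pass the head a, and the factor t
    that this costs accounts for the additional part s + 1 in [a :: l]. *)
Lemma term2_lt s a l X : all (geq a) l -> sorted geq l -> (s < a)%N ->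
  coef2 s l * hl (a :: up2 s l) X - coef11 s l * hl (a :: up11 s l) X =
  term2 s (a :: l) X.
Proof.
move=> la sl sa; have nas : (a == s) = false by rewrite gtn_eqF.
rewrite /term2 up11_lt // /coef11 /tmult /tmult1 /= nas; congr (_ - _).
have [sa1|] := ltnP s.+1 a.
  by rewrite up2_lt // /coef2 /tmult /= nas (gtn_eqF sa1).
rewrite leq_eqVlt ltnS leqNgt sa orbF => /eqP ea; subst a.
have las : all (geq s.+2) l by apply: sub_all la => y; rewrite /geq /=; lia.
have sal : sorted geq (s.+1 :: l) by rewrite sorted_geq_cons la.
have lsal : all (geq s.+2) (s.+1 :: l) by rewrite /= las /geq /= leqnSn.
rewrite up2_le // (up2_le sal lsal) /= nas.
rewrite hl_head_swap // /coef2 /tmult /= nas eqxx add1n exprS.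
by case: (s == 0%N); ring.
Qed.

(** Put m = m_a(l). After straightening, the coefficient of Q_(a+2,a,...) is (1 - t^2) + t (1 + t)(1
    - t^m) = (1 + t)(1 - t^(m+1)), and that of Q_(a+1,a+1,...) is - (1 - t^m)((1 - t^2) + t^2 (1 -
    t^(m-1))) = - (1 - t^m)(1 - t^(m+1)). The cases m = 0 and m = 1 are separate because the lists
    then lack the copies of a to be moved. *)
Lemma term2_eq a l X : all (geq a) l -> sorted geq l -> (0 < a)%N ->
  (1 - t ^+ 2) * hl (a.+2 :: l) X +
  (coef2 a l * hl (a :: up2 a l) X - coef11 a l * hl (a :: up11 a l) X) =
  term2 a (a :: l) X.
Proof.
move=> la sl a0; have na : (a == 0%N) = false by rewrite gtn_eqF.
have aSa : (a == a.+1) = false by rewrite ltn_eqF.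
have sal : sorted geq (a :: l) by rewrite sorted_geq_cons la.
have la1 : all (geq a.+1) l by apply: sub_all la => y; rewrite /geq /=; lia.
have la2 : all (geq a.+2) l by apply: sub_all la => y; rewrite /geq /=; lia.
have cSa : count_mem a.+1 l = 0%N.
  by apply/count_memPn/negP => /(allP la); rewrite /geq /= ltnn.
rewrite /term2 [up2 a (a :: l)]up2_le //=; last by rewrite /geq /= la2; lia.
rewrite [up11 a (a :: l)]up11_le //=; last by rewrite /geq /= la1; lia.
rewrite eqxx.
have [al|al] := boolP (a \in l); last first.
  have c0 : count_mem a l = 0%N by apply/count_memPn.
  rewrite (coef2_0 a0 al) (coef11_0 a0 al) (@coef11_1 a (a :: l)) //=; last first.
    by rewrite eqxx c0.
  by rewrite /coef2 /tmult /= cSa na eqxx c0 aSa; ring.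
have [l' el] := sorted_geq_head la sl al.
rewrite up2_le // up11_le // el /= eqxx.
have la' : all (geq a) l' by move: la; rewrite el /= => /andP[].
have sl' : sorted geq l' by move: sl; rewrite el sorted_geq_cons => /andP[].
rewrite hl_head_swap2 // -el.
have [al'|al'] := boolP (a \in l'); last first.
  have c0 : count_mem a l' = 0%N by apply/count_memPn.
  rewrite (@coef11_1 a l) //; last by rewrite el /= eqxx c0.
  rewrite /coef2 /coef11 /tmult /tmult1 /= cSa na eqxx el /= eqxx c0 /=.
  by rewrite aSa /=; ring.
have [l'' el'] := sorted_geq_head la' sl' al'.
rewrite el' /= eqxx.
rewrite (@hl_head_swap _ _ x t) //.
rewrite (hl_cons_ext _ _ (fun Y => hl_head_swap t x_inj two_neq0 a l'' Y)).
rewrite /coef2 /coef11 /tmult /tmult1 /= cSa na eqxx el el' /= eqxx /=.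
by rewrite !aSa !add1n !add0n /= !exprS; ring.
Qed.

(** Adding a head a changes the sum at s = a only, where the term that raises a itself is absorbed;
    below a the terms are merely straightened, and above a they vanish on both sides. The common
    bound [n] keeps the range of s fixed in the induction. *)
Lemma power2_hl n l X : sorted geq l -> 0%N \notin l -> (0 < n)%N -> all (gtn n) l ->
  (1 - t ^+ 2) * power x 2 X * hl l X = \sum_(s < n) term2 s l X.
Proof.
move=> + + n0; elim: l X => [|a l IH] X.
  move=> _ _ _; rewrite hl_nil mulr1 power2_base; case: n n0 => // n _.
  rewrite big_ord_recl big1 ?addr0.
    by rewrite /term2 /coef2 /coef11 /tmult /tmult1 /= expr0; ring.
  by move=> s _; rewrite /term2 coef2_0 // coef11_0 // !mul0r subrr.
rewrite sorted_geq_cons inE negb_or => /andP[la sl] /andP[a0 l0] /= /andP[an ln].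
have {}a0 : (0 < a)%N by rewrite lt0n eq_sym.
rewrite (@power2_hl_rec n); last by move=> Y; apply: IH.
rewrite (bigD1 (Ordinal an)) //= addrA term2_eq // [RHS](bigD1 (Ordinal an)) //=.
congr (_ + _); apply: eq_bigr => s sa.
have [lt_sa|] := ltnP s a; first exact: term2_lt.
rewrite leq_eqVlt => /orP[/eqP e|as_].
  by move: sa; rewrite -val_eqE /= e eqxx.
have s0 : (0 < s)%N by apply: leq_ltn_trans as_.
have sl' : (s : nat) \notin l.
  by apply/negP => /(allP la); rewrite /geq /= leqNgt as_.
have sal : (s : nat) \notin a :: l by rewrite inE negb_or sl' gtn_eqF.
by rewrite /term2 !coef2_0 // !coef11_0 // !mul0r subrr.
Qed.

End PowerSum2.

(** * Expansions independent of the number of variables *)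

Section Frac.
Variables (R : realType) (N : nat).

HB.instance Definition _ := GRing.Field.on (XFrac R N).

Fact ratC_is_zmod_morphism : zmod_morphism (@ratC R N).
Proof. by move=> a b; rewrite /ratC mpolyCB rmorphB. Qed.

Fact ratC_is_monoid_morphism : monoid_morphism (@ratC R N).
Proof. by split=> [|a b]; rewrite /ratC ?mpolyC1 ?rmorph1 // mpolyCM rmorphM. Qed.

HB.instance Definition _ := GRing.isZmodMorphism.Build R (XFrac R N) (@ratC R N)
  ratC_is_zmod_morphism.
HB.instance Definition _ := GRing.isMonoidMorphism.Build R (XFrac R N) (@ratC R N)
  ratC_is_monoid_morphism.

Lemma ratX_inj : injective (@ratX R N).
Proof.
move=> i j /eqP; rewrite tofrac_eq => /eqP/(congr1 (mpoly.mcoeff (mnm1 j))).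
rewrite !mcoeffX eqxx; case: eqP => [/mnmP/(_ i)|_ /eqP]; last by rewrite eq_sym oner_eq0.
by rewrite !mnm1E eqxx; case: (j =P i).
Qed.

Lemma ratX_neq0 i : @ratX R N i != 0.
Proof.
rewrite tofrac_eq0; apply/eqP => /(congr1 (mpoly.mcoeff (mnm1 i)))/eqP.
by rewrite mcoeffX eqxx mpoly.mcoeff0 oner_eq0.
Qed.

Lemma XFrac_two_neq0 : 2%:R != 0 :> XFrac R N.
Proof. by rewrite -(rmorph_nat (@ratC R N)) fmorph_eq0 pnatr_eq0. Qed.

End Frac.

Section Stable.
Variables (R : realType) (t : R).
Hypothesis t_bnd : -1 < t < 0.

Definition HLQ (N : nat) (l : seq nat) (X : {set 'I_N}) : XFrac R N :=
  hl (@ratX R N) (ratC N t) l X.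

Definition is_intpart (l : seq nat) : bool := sorted geq l && (0%N \notin l).

(* The coefficients and the indices in [cs] depend neither on N nor on X. *)
Definition stable (P : pred (seq nat)) (h : forall N, {set 'I_N} -> XFrac R N) :=
  exists2 cs : seq (R * seq nat), all (fun c => P c.2) cs &
    forall N X, h N X = \sum_(c <- cs) ratC N c.1 * HLQ c.2 X.

Lemma one_subXn_neq0 j : (0 < j)%N -> 1 - t ^+ j != 0.
Proof.
move=> j0; case/andP: t_bnd => t1 t0; rewrite subr_eq0 eq_sym.
apply/eqP => /(congr1 (fun y => `|y|)); rewrite normrX normr1 => /eqP.
by rewrite pexpr_eq1 // ?normr_ge0 // ltr0_norm // => /eqP; lra.
Qed.

Section StableClosure.
Variable P : pred (seq nat).

Lemma stable_ext h h' : (forall N X, h N X = h' N X) -> stable P h -> stable P h'.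
Proof. by move=> e [cs cP ch]; exists cs => // N X; rewrite -e. Qed.

Lemma stableD h h' : stable P h -> stable P h' -> stable P (fun N X => h N X + h' N X).
Proof.
move=> [cs cP ch] [ds dP dh]; exists (cs ++ ds); first by rewrite all_cat cP.
by move=> N X; rewrite big_cat ch dh.
Qed.

Lemma stableZ c h : stable P h -> stable P (fun N X => ratC N c * h N X).
Proof.
move=> [cs cP ch]; exists [seq (c * d.1, d.2) | d <- cs]; first by rewrite all_map.
move=> N X; rewrite big_map ch mulr_sumr; apply: eq_bigr => d _.
by rewrite rmorphM mulrA.
Qed.

Lemma stable_HLQ l : P l -> stable P (fun N X => HLQ l X).
Proof.
move=> Pl; exists [:: (1, l)]; first by rewrite /= Pl.
by move=> N X; rewrite big_seq1 rmorph1 mul1r.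
Qed.

Lemma stable0 : stable P (fun N X => 0).
Proof. by exists [::] => // N X; rewrite big_nil. Qed.

Lemma stableN h : stable P h -> stable P (fun N X => - h N X).
Proof. by move/(stableZ (-1)); apply: stable_ext => N X; rewrite rmorphN1 mulN1r. Qed.

End StableClosure.

Definition linear_op (f : forall N, ({set 'I_N} -> XFrac R N) -> {set 'I_N} -> XFrac R N) :=
  (forall N X, f N (fun=> 0) X = 0) /\
  (forall N X a y z, f N (fun Y => ratC N a * y Y + z Y) X = ratC N a * f N y X + f N z X).

Lemma stable_bind (P Q : pred (seq nat)) f h : linear_op f ->
  (forall l, P l -> stable Q (fun N => f N (HLQ l))) ->
  stable P h -> stable Q (fun N => f N (h N)).
Proof.
move=> [f0 fl] fP [cs cP ch]; apply: (stable_ext (h := fun N =>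
  f N (fun Y => \sum_(c <- cs) ratC N c.1 * HLQ c.2 Y))).
  by move=> N X; congr (f N _ X); apply/funext => Y; rewrite ch.
elim: cs cP {ch} => [_|c cs IH /= /andP[Pc Pcs]].
  apply: stable_ext (stable0 Q) => N X; rewrite -[LHS](f0 N X).
  by congr (f N _ X); apply/funext => Y; rewrite big_nil.
apply: (stable_ext (h := fun N X => ratC N c.1 * f N (HLQ c.2) X +
  f N (fun Y => \sum_(c <- cs) ratC N c.1 * HLQ c.2 Y) X)).
  by move=> N X; rewrite -fl; congr (f N _ X); apply/funext => Y; rewrite big_cons.
by apply: stableD (IH Pcs); apply: stableZ; apply: fP.
Qed.

(** Prefixing of a part: [HLQ l] goes to [HLQ (a :: l)]. It acts on functions of the variable set,
    as it evaluates [h] on X with one variable removed. *)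
Definition cons_op a N (h : {set 'I_N} -> XFrac R N) (X : {set 'I_N}) : XFrac R N :=
  (1 - ratC N t) * \sum_(i in X) ratX R i ^+ a *
    (\prod_(j in X :\ i) hlfactor (@ratX R N) (ratC N t) i j) * h (X :\ i).

Lemma cons_op_linear a : linear_op (@cons_op a).
Proof.
split=> [N X|N X c y z]; rewrite /cons_op.
  by rewrite big1 ?mulr0 // => i _; rewrite mulr0.
rewrite mulrCA -mulrDr; congr (_ * _); rewrite mulr_sumr -big_split /=.
by apply: eq_bigr => i _; ring.
Qed.

Definition mul_op (g : forall N, {set 'I_N} -> XFrac R N) N
  (h : {set 'I_N} -> XFrac R N) (X : {set 'I_N}) : XFrac R N := g N X * h X.

Lemma mul_op_linear g : linear_op (@mul_op g).
Proof.
split=> [N X|N X c y z]; rewrite /mul_op ?mulr0 //; ring.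
Qed.

(** * Multiplication by elementary functions and power sums *)

Definition le_intpart a (n : nat) l := [&& is_intpart l, all (geq a) l & sumn l == n].

Definition eln k N (X : {set 'I_N}) := elem (@ratX R N) k X.
Definition pown k N (X : {set 'I_N}) := power (@ratX R N) k X.

(** Since no part exceeds a + 1, the part a has to pass only the copies of a + 1, each at the cost
    of a factor t. *)
Lemma HLQ_insert a N (X : {set 'I_N}) l : sorted geq l -> all (geq a.+1) l ->
  HLQ (a :: l) X = ratC N (t ^+ count_mem a.+1 l) * HLQ (sort geq (a :: l)) X.
Proof.
elim: l X => [|b l IH] X; first by rewrite /= rmorph1 mul1r.
rewrite sorted_geq_cons => /andP[bl sl] /= /andP[ba la].
move: ba; rewrite /geq /= leq_eqVlt => /orP[/eqP eb|]; last first.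
  rewrite ltnS => ba.
  have lab : all (geq a) (b :: l).
    by rewrite /= ba; apply: sub_all bl => y; rewrite /geq /= => /leq_trans; apply.
  have -> : (b == a.+1) = false by rewrite ltn_eqF.
  have -> : count_mem a.+1 l = 0%N.
    apply/count_memPn/negP => h; have := allP lab a.+1.
    by rewrite inE h orbT => /(_ isT); rewrite /geq /= ltnn.
  by rewrite rmorph1 mul1r sort_geq_id // sorted_geq_cons lab sorted_geq_cons bl.
subst b; rewrite eqxx add1n exprS rmorphM.
rewrite /HLQ hl_head_swap; [|exact: ratX_inj|exact: XFrac_two_neq0].
rewrite -mulrA; congr (_ * _).
have -> : sort geq [:: a, a.+1 & l] = a.+1 :: sort geq (a :: l).
  rewrite -sort_geq_cons; last by rewrite /= bl /geq /= leqnSn.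
  exact/sort_geq_perm/(permEl (perm_catCA [:: a] [:: a.+1] l)).
by apply: hl_cons_ext => Y; apply: IH.
Qed.

Lemma stable_cons (b n a : nat) h : stable (le_intpart a.+1 n) h ->
  (0 < a)%N -> (a <= b)%N -> stable (le_intpart b.+1 (a + n)%N) (fun N => cons_op a (h N)).
Proof.
move=> sh a0 ab; apply: stable_bind (cons_op_linear a) _ sh.
move=> l /and3P[/andP[sl l0] la /eqP sn].
apply: (stable_ext (h := fun N X => ratC N (t ^+ count_mem a.+1 l) *
   HLQ (sort geq (a :: l)) X)).
  by move=> N X; rewrite -HLQ_insert.
apply: stableZ; apply: stable_HLQ; apply/and3P; split.
- apply/andP; split; first by apply: sort_sorted => p q; apply: leq_total.
  by rewrite mem_sort inE negb_or l0 andbT eq_sym -lt0n.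
- rewrite all_sort /= /geq /= leqW // andTb; apply: sub_all la => y.
  by rewrite /geq /= => /leq_trans; apply.
- by rewrite (perm_sumn (permEl (perm_sort _ _))) /= sn.
Qed.

Lemma stable_weaken (P Q : pred (seq nat)) h :
  (forall l, P l -> Q l) -> stable P h -> stable Q h.
Proof. by move=> PQ [cs cP ch]; exists cs => //; apply: sub_all cP => c /PQ. Qed.

(** A qualitative Pieri rule. Multiplication by e_k raises parts by at most 1, which is why the
    bound grows from a to a + 1. So if the head b is kept, it is reinserted by [HLQ_insert]; if it
    is raised to b + 1, the list is already sorted. *)
Lemma stable_eln a n (k : nat) l : le_intpart a n l ->
  stable (le_intpart a.+1 (k + n)%N) (fun N X => eln k X * HLQ l X).
Proof.
elim: l a n k => [|b l IH] a n k /and3P[/andP[sl l0] la /eqP sn].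
  have c0 : \prod_(1 <= j < k.+1) (1 - t ^+ j) != 0.
    by rewrite prodf_seq_neq0; apply/allP => j; rewrite mem_index_iota => /andP[j0 _];
       rewrite one_subXn_neq0.
  (* On the empty partition, e_k is Q_(1^k) divided by the constant of [hl_ones]. *)
  apply: (stable_ext (h := fun N X =>
     ratC N (\prod_(1 <= j < k.+1) (1 - t ^+ j))^-1 * HLQ (nseq k 1%N) X)).
    move=> N X; rewrite /HLQ hl_nil mulr1 hl_ones; [|exact: ratX_inj|exact: ratX_neq0].
    rewrite mulrA fmorphV rmorph_prod.
    have -> : \prod_(1 <= j < k.+1) (1 - ratC N t ^+ j) =
       \prod_(1 <= j < k.+1) ratC N (1 - t ^+ j).
      by apply: eq_bigr => j _; rewrite rmorphB rmorph1 rmorphXn.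
    rewrite -rmorph_prod mulVf ?mul1r // fmorph_eq0 //.
  apply: stableZ; apply: stable_HLQ; apply/and3P; split.
  - apply/andP; split; last by apply/negP => /nseqP[].
    by apply: path_sorted (_ : path geq 1%N _); elim: k {c0} => //= k ->.
  - by apply/allP => y /nseqP[-> _]; rewrite /geq.
  - by rewrite sumn_nseq mul1n -sn /= addn0.
have [/= bl sl'] : all (geq b) l /\ sorted geq l.
  by apply/andP; rewrite -sorted_geq_cons.
move: l0 la => /=; rewrite inE negb_or => /andP[b0 l0] /andP[ba la].
have {}b0 : (0 < b)%N by rewrite lt0n eq_sym.
have lP : le_intpart b (sumn l) l by rewrite /le_intpart /is_intpart sl' l0 bl eqxx.
case: k => [|k].
  apply: (stable_ext (h := fun N X => HLQ (b :: l) X)).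
    by move=> N X; rewrite /eln elem0 mul1r.
  apply: stable_HLQ; rewrite /le_intpart /is_intpart sl inE negb_or l0 -sn eqxx andbT /=.
  rewrite eq_sym -lt0n b0 /= andbT {1}/geq /= leqW //=.
  by apply: sub_all la => y; rewrite /geq /=; apply: leqW.
apply: (stable_ext (h := fun N X => cons_op b (fun Y => eln k.+1 Y * HLQ l Y) X +
   cons_op b.+1 (fun Y => eln k Y * HLQ l Y) X)).
  by move=> N X; rewrite /eln /HLQ elem_hl_cons.
apply: stableD.
  have := @stable_cons a _ _ _ (IH _ _ k.+1 lP) b0 ba.
  by rewrite -sn addnCA.
apply: stable_bind (cons_op_linear _) _ (IH _ _ k lP).
move=> l1 /and3P[/andP[sl1 l10] l1b /eqP sn1].
apply: (stable_ext (h := fun N X => HLQ (b.+1 :: l1) X)) => //.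
apply: stable_HLQ; apply/and3P; split.
- by rewrite /is_intpart sorted_geq_cons l1b sl1.
- rewrite /= {1}/geq /= ltnS ba /=; apply: sub_all l1b => y; rewrite /geq /=.
  by move=> h; rewrite (leq_trans h).
- by rewrite /= sn1 -sn /= addSn addSn addnCA.
Qed.

Definition weight_intpart (n : nat) l := is_intpart l && (sumn l == n).

Lemma stable_mul_eln (n k : nat) h : stable (weight_intpart n) h ->
  stable (weight_intpart (k + n)%N) (fun N X => eln k X * h N X).
Proof.
move=> sh; apply: (stable_bind (mul_op_linear (@eln k)) _ sh) => l /andP[lP ln].
have lP' : le_intpart (\max_(i <- l) i) n l.
  by rewrite /le_intpart lP ln andbT; apply/allP => y yl; rewrite /geq /= leq_bigmax_seq.
apply: stable_weaken (stable_eln k lP') => l1 /and3P[h1 _ h2].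
by rewrite /weight_intpart h1 h2.
Qed.

Definition hookn m r N (X : {set 'I_N}) := hook (@ratX R N) m r X.

(** By [hookS], hook (m+1) r = p_(m+1) e_(r+1) - hook m (r+1), and p_(m+1) is hook m 0; thus m
    decreases while r has to stay arbitrary, down to the multiples of e_(r+1) at m = 0. *)
Lemma stable_mul_hookn (m r n : nat) h : stable (weight_intpart n) h ->
  stable (weight_intpart (m + r.+1 + n)%N) (fun N X => hookn m r X * h N X).
Proof.
elim: m r n h => [|m IH] r n h sh.
  apply: (stable_ext (h := fun N X => ratC N r.+1%:R * (eln r.+1 X * h N X))).
    by move=> N X; rewrite /hookn hook_elem rmorph_nat mulrA.
  by apply: stableZ; apply: stable_mul_eln.
apply: (stable_ext (h := fun N X => hookn m 0 X * (eln r.+1 X * h N X) +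
   - (hookn m r.+1 X * h N X))).
  move=> N X; rewrite /hookn hookS hook0 /eln; ring.
apply: stableD; last by rewrite addSnnS; apply/stableN/IH.
have -> : (m.+1 + r.+1 + n = m + 1 + (r.+1 + n))%N by lia.
by apply: IH; apply: stable_mul_eln.
Qed.

Lemma stable_powers l : 0%N \notin l ->
  stable (weight_intpart (sumn l)) (fun N X => \prod_(r <- l) pown r X).
Proof.
elim: l => [_|r l IH].
  apply: (stable_ext (h := fun N X => HLQ [::] X)).
    by move=> N X; rewrite big_nil.
  exact: stable_HLQ.
rewrite inE negb_or => /andP[r0 /IH sl].
case: r r0 => // r _.
apply: (stable_ext (h := fun N X => hookn r 0 X * \prod_(r <- l) pown r X)).
  by move=> N X; rewrite big_cons /hookn hook0.
by rewrite /= -[r.+1]addn1; apply: stable_mul_hookn.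
Qed.

End Stable.

(** * Symmetrization over permutations *)

Lemma lift_perm_bij n :
  bijective (fun p : 'I_n.+1 * 'S_n => lift_perm ord0 p.1 p.2).
Proof.
apply: inj_card_bij => [[i s] [j u] /= e|]; last first.
  by rewrite card_prod !card_Sn card_ord factS.
have ij : i = j by rewrite -(lift_perm_id ord0 i s) e lift_perm_id.
subst j; congr (_, _); apply/permP => k.
by apply: (@lift_inj _ i); rewrite -!(lift_perm_lift ord0) e.
Qed.

(** The value w(0) selects the variable of the head, and the rest of w is a permutation of n indices
    seen through [lift]. The labelling [f] is general because the remaining variables are relabelled
    at each stage. *)
Lemma hl_perm_sum (F : fieldType) (I : finType) (x : I -> F) (t : F) n
    (f : 'I_n -> I) (l : seq nat) : injective f -> size l = n ->
  (1 - t) ^+ n * \sum_(w : 'S_n) (\prod_(i < n) x (f (w i)) ^+ nth 0%N l i) *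
     \prod_(i < n) \prod_(j < n | (i < j)%N) hlfactor x t (f (w i)) (f (w j)) =
  hl x t l [set f i | i : 'I_n].
Proof.
elim: n f l => [|n IH] f [|a l] // f_inj.
  move=> _; rewrite mul1r (big_pred1 1%g) ?big_ord0 ?mulr1 //.
  by move=> w; apply/esym/eqP/permP => -[].
move=> [sl]; have bij := lift_perm_bij n.
rewrite (reindex _ (onW_bij _ bij)) /=.
rewrite -(pair_bigA _ (fun i w => (\prod_(k < n.+1) x (f (lift_perm ord0 i w k)) ^+ nth 0%N (a :: l) k) *
     \prod_(k < n.+1) \prod_(j < n.+1 | (k < j)%N)
       hlfactor x t (f (lift_perm ord0 i w k)) (f (lift_perm ord0 i w j)))) /=.
rewrite exprS -mulrA hl_cons; congr (_ * _).
rewrite big_imset /=; last by move=> i j _ _; apply: f_inj.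
rewrite mulr_sumr; apply: eq_bigr => i _.
have fl_inj : injective (fun k : 'I_n => f (lift i k)).
  by move=> j k /f_inj/lift_inj.
have -> : [set f k | k : 'I_n.+1] :\ f i = [set f (lift i k) | k : 'I_n].
  apply/setP => y; rewrite !inE; apply/andP/imsetP => [[yi /imsetP[k _ e]]|[k _ ->]].
    have [j ek|ek] := unliftP i k; first by exists j; rewrite // e ek.
    by rewrite e ek eqxx in yi.
  split; last by apply/imsetP; exists (lift i k).
  by apply/eqP => /f_inj/eqP; rewrite eq_sym (negPf (neq_lift _ _)).
rewrite -(IH _ l fl_inj sl) mulrCA; congr (_ * _); rewrite mulr_sumr.
apply: eq_bigr => w _; rewrite big_ord_recl lift_perm_id /= -!mulrA; congr (_ * _).
rewrite [X in _ * X = _]big_ord_recl lift_perm_id.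
rewrite [\prod_(j < n.+1 | (ord0 < j)%N) _]big_mkcond big_ord_recl /= mul1r.
rewrite mulrCA; congr (_ * (_ * _)).
- rewrite big_imset /=; last by move=> j k _ _; apply: fl_inj.
  rewrite [RHS](reindex_inj (@perm_inj _ w)) /=.
  by apply: eq_bigr => k _; rewrite lift_perm_lift.
- by apply: eq_bigr => k _; rewrite lift_perm_lift.
apply: eq_bigr => k _; rewrite big_mkcond big_ord_recl /= mul1r [RHS]big_mkcond.
by apply: eq_bigr => j _; rewrite !lift_perm_lift.
Qed.

(** * Specialization of symmetric functions *)

Section Spec.
Variables (R : realType) (N : nat).

Definition xpow (r : nat) : XPol R N := \sum_(j < N) polyvar R j ^+ r.

Definition specmon (m : {cmonom nat}) : XPol R N :=
  \prod_(i <- finsupp (cmonom_val m)) xpow i.+1 ^+ cmonom_val m i.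

Lemma specmonE (D : {fset nat}) (m : {cmonom nat}) :
  (finsupp (cmonom_val m) `<=` D)%fset -> specmon m = \prod_(i <- D) xpow i.+1 ^+ m i.
Proof.
move=> mD; rewrite /specmon (big_fset_incl _ mD) //= => i _ im.
by rewrite fsfun_dflt // expr0.
Qed.

Fact specmon_mmorphism : mmorphism specmon.
Proof.
split=> [m1 m2|]; last first.
  by rewrite (@specmonE fset0) ?big_seq_fset0 // mdom1.
pose D := (finsupp (cmonom_val m1) `|` finsupp (cmonom_val m2))%fset.
rewrite !(@specmonE D) ?fsubsetUl ?fsubsetUr // -?big_split /=.
  by apply: eq_bigr => i _; rewrite cmM exprD.
by rewrite mdomD.
Qed.

HB.instance Definition _ := isMultiplicative.Build {cmonom nat} (XPol R N) specmon
  specmon_mmorphism.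

Fact spec_is_zmod_morphism : zmod_morphism (@spec R N).
Proof.
move=> f g; have := monalg.mmapB (f := @mpolyC N R) (h := specmon) f g; exact.
Qed.

Fact spec_is_monoid_morphism : monoid_morphism (@spec R N).
Proof.
have [hM h1] := monalg.mmap_is_multiplicative
  (f := (@mpolyC N R : {rmorphism R -> XPol R N})) (h := specmon).
by split=> [|f g]; [exact: h1 | exact: hM].
Qed.

HB.instance Definition _ := GRing.isZmodMorphism.Build (SymF R) (XPol R N) (@spec R N)
  spec_is_zmod_morphism.
HB.instance Definition _ := GRing.isMonoidMorphism.Build (SymF R) (XPol R N) (@spec R N)
  spec_is_monoid_morphism.

Lemma specU (c : R) m : spec N (<< c *g m >> : SymF R) = mpolyC N c * specmon m.
Proof. exact: (monalg.mmapU (f := @mpolyC N R) (h := specmon)). Qed.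

Lemma specZ (c : R) (f : SymF R) : spec N (c *: f) = mpolyC N c * spec N f.
Proof.
exact: (monalg.mmapZ (f := (@mpolyC N R : {rmorphism R -> XPol R N}))
  (h := specmon : {mmorphism {cmonom nat} -> XPol R N})).
Qed.

Lemma specE (f : SymF R) : spec N f =
  \sum_(m <- monalg.msupp f) mpolyC N (monalg.mcoeff m f) * specmon m.
Proof. by []. Qed.

Lemma spec_psum k : (0 < k)%N -> spec N (psum R k) = xpow k.
Proof.
move=> k0; rewrite /psum specU mul1r (@specmonE [fset k.-1]%fset) ?mdomU //.
by rewrite big_seq_fset1 cmUU expr1 prednK.
Qed.

Lemma tofrac_xpow k : tofrac (xpow k) = power (@ratX R N) k [set: 'I_N].
Proof.
rewrite rmorph_sum /= /power; apply: eq_big => [i|i _]; first by rewrite inE.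
by rewrite rmorphXn.
Qed.

End Spec.

(** The partition formed by the indices of a monomial in power sums; the shift is there because
    variable i stands for p_(i+1). Its inverse is [cmon]. *)
Definition lseq (m : {cmonom nat}) : seq nat :=
  sort geq (flatten [seq nseq (m i) i.+1 | i <- finsupp (cmonom_val m)]).

Definition cmon (l : seq nat) : {cmonom nat} :=
  foldr (fun r m => mmul (ucm r.-1) m) mone l.

Lemma lseq_is_intpart m : is_intpart (lseq m).
Proof.
rewrite /is_intpart sort_sorted ?mem_sort; last by move=> p q; apply: leq_total.
by apply/negP => /flattenP[_ /mapP[i _ ->] /nseqP[]].
Qed.

Lemma count_lseq m i : count_mem i.+1 (lseq m) = m i.
Proof.
rewrite /lseq (seq.permP (permEl (perm_sort _ _))) count_flatten sumnE !big_map.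
have [im|im] := boolP (i \in finsupp (cmonom_val m)).
  rewrite (bigD1_seq i) ?fset_uniq //= count_nseq /= eqxx mul1n big1 ?addn0 //.
  by move=> j ji; rewrite count_nseq /= eqSS (negPf ji) mul0n.
rewrite big_seq big1 ?fsfun_dflt // => j jm; rewrite count_nseq /= eqSS.
by case: eqP => // ji; move: im; rewrite -ji jm.
Qed.

Lemma cmonE l i : 0%N \notin l -> cmon l i = count_mem i.+1 l.
Proof.
elim: l => [_|r l IH]; first by rewrite cm1.
rewrite inE negb_or => /andP[r0 /IH {}IH]; rewrite /= cmM IH cmU.
by case: r r0 => // r _; rewrite eqSS.
Qed.

Lemma lseqK m : cmon (lseq m) = m.
Proof.
apply/eqP/cmP => i; have /andP[_ h] := lseq_is_intpart m.
by rewrite cmonE // count_lseq.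
Qed.

Lemma perm_eq_pos (l1 l2 : seq nat) : 0%N \notin l1 -> 0%N \notin l2 ->
  (forall i, count_mem i.+1 l1 = count_mem i.+1 l2) -> perm_eq l1 l2.
Proof.
move=> h1 h2 h; apply/allP => -[|i] _ /=; last by rewrite h.
by rewrite (count_memPn h1) (count_memPn h2).
Qed.

Lemma is_intpart_eq l1 l2 : is_intpart l1 -> is_intpart l2 ->
  (forall i, count_mem i.+1 l1 = count_mem i.+1 l2) -> l1 = l2.
Proof.
move=> /andP[s1 h1] /andP[s2 h2] h.
by rewrite -(sort_geq_id s1); apply: sort_geq_eq => //; apply: perm_eq_pos.
Qed.

Lemma cmonK l : is_intpart l -> lseq (cmon l) = l.
Proof.
move=> hl; have /andP[_ h0] := hl.
by apply: is_intpart_eq => // [|i]; rewrite ?lseq_is_intpart // count_lseq cmonE.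
Qed.

Lemma sum_nth_count (P : pred nat) N l : (size l <= N)%N -> ~~ P 0%N ->
  (\sum_(j < N) P (nth 0%N l j) = count P l)%N.
Proof.
move=> + P0; elim: l N => [|r l IH] N; first by rewrite big1 // => j _; rewrite nth_nil (negPf P0).
by case: N => // N lN; rewrite big_ord_recl /= IH.
Qed.

(** * Independence of the power sums in sufficiently many variables *)

Section SpecInj.
Variables (R : realType).

Definition pmon (l : seq nat) : SymF R := \prod_(r <- l) psum R r.

Lemma mkmalgUM (m1 m2 : {cmonom nat}) :
  (<< m1 >> : SymF R) * << m2 >> = << mmul m1 m2 >>.
Proof. by have := @fgmulUU _ R 1 1 m1 m2; rewrite mulr1 => <-; apply: malgM_def. Qed.

Lemma pmonE l : pmon l = << cmon l >>.
Proof.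
elim: l => [|r l IH]; first by rewrite /pmon big_nil.
have -> : pmon (r :: l) = psum R r * pmon l by exact: big_cons.
rewrite IH; exact: mkmalgUM.
Qed.

Lemma spec_pmon N l : 0%N \notin l -> spec N (pmon l) = \prod_(r <- l) xpow R N r.
Proof.
move=> l0; rewrite rmorph_prod; apply: eq_big_seq => r rl.
by apply: spec_psum; rewrite lt0n; apply: contraNneq l0 => <-.
Qed.

Section PowerCoef.
Variable N : nat.

Definition pcoef (l : seq nat) (g : 'X_{1..N}) : R :=
  mpoly.mcoeff g (\prod_(r <- l) xpow R N r).

Lemma pcoef_cons r l g : pcoef (r :: l) g =
  \sum_(j < N) mpoly.mcoeff g ((\prod_(r <- l) xpow R N r) * mpolyX R (U_(j) *+ r)%MM).
Proof.
rewrite /pcoef big_cons mulrC mulr_sumr raddf_sum /=; apply: eq_bigr => j _.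
by rewrite /polyvar mpolyXn.
Qed.

Lemma pcoef_split l g m : mpoly.mcoeff g ((\prod_(r <- l) xpow R N r) * mpolyX R m) != 0 ->
  exists2 g', g = (m + g')%MM &
    mpoly.mcoeff g ((\prod_(r <- l) xpow R N r) * mpolyX R m) = pcoef l g'.
Proof.
rewrite -mcoeff_msupp (perm_mem (msuppMX _ _)) => /mapP[g' _ ->].
by exists g'; rewrite // mcoeffMX.
Qed.

Lemma pcoef_term_ge0 l g m : (forall h, 0 <= pcoef l h) ->
  0 <= mpoly.mcoeff g ((\prod_(r <- l) xpow R N r) * mpolyX R m).
Proof.
move=> ge0.
have [->//|] := eqVneq (mpoly.mcoeff g ((\prod_(r <- l) xpow R N r) * mpolyX R m)) 0.
by move=> /pcoef_split[h _ ->].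
Qed.

Lemma pcoef_ge0 l g : 0 <= pcoef l g.
Proof.
elim: l g => [|r l IH] g; first by rewrite /pcoef big_nil mpoly.mcoeff1 ler0n.
by rewrite pcoef_cons; apply: sumr_ge0 => j _; apply: pcoef_term_ge0.
Qed.

(** Giving the parts of l to the variables d, d + 1, ... in turn produces this monomial, and
    nonnegativity excludes cancellation. The offset [d] lets the induction drop the first part. *)
Lemma pcoef_gt0 l d (g : 'X_{1..N}) : (d + size l <= N)%N ->
  (forall j : 'I_N, g j = if (d <= j)%N then nth 0%N l (j - d) else 0%N) ->
  0 < pcoef l g.
Proof.
elim: l d g => [|r l IH] d g dN gE.
  rewrite /pcoef big_nil mpoly.mcoeff1 (_ : g == 0%MM) ?ltr01 //.
  by apply/eqP/mnmP => j; rewrite gE mnm0E nth_nil if_same.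
have dN' : (d < N)%N by move: dN; rewrite /=; lia.
pose j0 := Ordinal dN'.
pose g' := [multinom if (d.+1 <= j)%N then nth 0%N l (j - d.+1) else 0%N | j < N].
have eg : g = (U_(j0) *+ r + g')%MM.
  apply/mnmP => j; rewrite gE mnmDE mulmnE mnm1E mnmE -val_eqE /=.
  case: ltngtP => [dj|dj|dj] //=; last by rewrite -dj subnn mul1n addn0.
  by rewrite mul0n add0n (_ : (j - d)%N = (j - d.+1).+1) //; lia.
rewrite pcoef_cons (bigD1 j0) //= ltr_wpDr //.
  by apply: sumr_ge0 => j _; apply: pcoef_term_ge0 => h; apply: pcoef_ge0.
rewrite eg mcoeffMX; apply: (IH d.+1); first by move: dN => /=; lia.
by move=> j; rewrite mnmE.
Qed.

(** A monomial of p_l arises by distributing the parts of l over the variables. It involves [size l]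
    variables only if no two parts meet in the same variable, and then its exponents are the
    parts. *)
Lemma pcoef_neq0 l (g : 'X_{1..N}) : 0%N \notin l -> pcoef l g != 0 ->
  (\sum_(j < N) (g j != 0%N) <= size l)%N /\
  (\sum_(j < N) (g j != 0%N) = size l ->
    forall i, \sum_(j < N) (g j == i.+1) = count_mem i.+1 l)%N.
Proof.
elim: l g => [|r l IH] g.
  rewrite /pcoef big_nil mpoly.mcoeff1 => _.
  have [-> _|_] := eqVneq g 0%MM; last by rewrite eqxx.
  by split=> [|_ i]; rewrite big1 // => j _; rewrite mnm0E.
rewrite inE negb_or pcoef_cons => /andP[r0 l0] nz.
have [j nzj] : exists j, mpoly.mcoeff g ((\prod_(r <- l) xpow R N r) *
    mpolyX R (U_(j) *+ r)%MM) != 0.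
  apply: contrapT => /forallNP h; move: nz; rewrite big1 ?eqxx // => j _.
  by apply/eqP; rewrite -[_ == _]negbK; apply/negP/h.
have [g' eg e] := pcoef_split nzj; rewrite e in nzj.
have [le eqc] := IH g' l0 nzj.
have gj k : k != j -> g k = g' k.
  by move=> kj; rewrite eg mnmDE mulmnE mnm1E eq_sym (negPf kj).
have gjj : g j = (r + g' j)%N by rewrite eg mnmDE mulmnE mnm1E eqxx mul1n.
have r0' : (0 < r)%N by rewrite lt0n eq_sym.
pose T := (\sum_(k < N | k != j) (g' k != 0%N))%N.
have e1 : (\sum_(k < N) (g k != 0%N))%N = T.+1.
  rewrite (bigD1 j) //= gjj -lt0n ltn_addr // add1n; congr (_.+1).
  by apply: eq_bigr => k kj; rewrite gj.
have e2 : (\sum_(k < N) (g' k != 0%N))%N = ((g' j != 0%N) + T)%N by rewrite (bigD1 j).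
rewrite e1 e2 in le eqc *; rewrite /= ltnS.
split=> [|eqs i]; first by rewrite (leq_trans _ le) ?leq_addl.
have g'j : g' j = 0%N by case: (g' j) le eqs => [|n] //=; lia.
rewrite g'j /= add0n in eqc; have {}eqc := eqc (succn_inj eqs) i.
rewrite (bigD1 j) //= gjj g'j addn0 -eqc [in RHS](bigD1 j) //= g'j add0n.
by congr addn; apply: eq_bigr => k kj; rewrite gj.
Qed.

End PowerCoef.

(* Among the monomials of f choose one with the largest number m of factors
   p_(l_1) ... p_(l_m); no other monomial of f contributes to the
   coefficient of x_1^(l_1) ... x_m^(l_m). *)
Lemma spec_inj (f : SymF R) n0 : (forall N, (n0 <= N)%N -> spec N f = 0) -> f = 0.
Proof.
move=> sf; apply/eqP; rewrite -monalg.msupp_eq0; apply/negPn/negP => /fset0Pn[m1 m1f].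
have [m0 m0f max_m0] : exists2 m0, m0 \in monalg.msupp f &
    forall m, m \in monalg.msupp f -> (size (lseq m) <= size (lseq m0))%N.
  pose m0 := [arg max_(m > [` m1f]%fset) size (lseq (val m))].
  exists (val m0); first exact: valP.
  move=> m mf; rewrite /m0; case: arg_maxnP => // i _ /(_ [` mf]%fset isT); exact.
pose N := maxn n0 (size (lseq m0)); pose l0 := lseq m0.
pose g := [multinom nth 0%N l0 j | j < N].
have /andP[_ z0] := lseq_is_intpart m0.
have sN : (size l0 <= N)%N by rewrite leq_maxr.
have suppg : (\sum_(j < N) (g j != 0%N))%N = size l0.
  under eq_bigr => j _ do rewrite mnmE.
  rewrite (@sum_nth_count (fun y => y != 0%N)) //; apply/eqP; rewrite -all_count.
  by apply/allP => y yl; apply: contraNneq z0 => <-.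
have := congr1 (mpoly.mcoeff g) (sf N (leq_maxl _ _)); rewrite mpoly.mcoeff0.
rewrite specE raddf_sum /= (bigD1_seq m0) ?fset_uniq //= big_seq_cond big1.
  have pE : specmon R N m0 = \prod_(r <- l0) xpow R N r.
    rewrite -{1}[m0]lseqK -/l0 -spec_pmon // pmonE specU mul1r //.
  rewrite addr0 mcoeffCM pE => /eqP; rewrite mulf_eq0 => /orP[|].
    by rewrite monalg.mcoeff_eq0 m0f.
  rewrite gt_eqF //; apply: (@pcoef_gt0 _ l0 0); first by rewrite add0n.
  by move=> j; rewrite mnmE subn0.
move=> m /andP[mf mm0]; have /andP[_ z] := lseq_is_intpart m.
have pE : specmon R N m = \prod_(r <- lseq m) xpow R N r.
  by rewrite -{1}[m]lseqK -spec_pmon // pmonE specU mul1r.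
rewrite mcoeffCM pE; have [->|nz] := eqVneq (mpoly.mcoeff g (\prod_(r <- lseq m) xpow R N r)) 0.
  by rewrite mulr0.
have [le eqc] := pcoef_neq0 z nz; rewrite suppg in le eqc.
(* Maximality of [m0] supplies the inequality opposite to [le]. *)
have /eqc {}eqc : size l0 = size (lseq m) by apply/eqP; rewrite eqn_leq le max_m0.
case/eqP: mm0; rewrite -[m]lseqK -[m0]lseqK; congr cmon.
apply: is_intpart_eq => [||i]; rewrite ?lseq_is_intpart // -eqc.
under eq_bigr => j _ do rewrite mnmE.
by rewrite (@sum_nth_count (pred1 i.+1)).
Qed.

End SpecInj.

(** * The basis of Hall-Littlewood functions *)

Lemma intpart_is_intpart (mu : intpart) : is_intpart mu.
Proof. exact: partsP. Qed.

Lemma sum_count_mem W (l : seq nat) : 0%N \notin l -> all (geq W) l ->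
  (\sum_(1 <= i < W.+1) count_mem i l = size l)%N.
Proof.
elim: l => [|r l IH]; first by rewrite big1.
rewrite inE negb_or => /andP[r0 l0] /= /andP[rW lW].
rewrite big_split /= IH // (bigD1_seq r) ?iota_uniq //=.
  by rewrite eqxx big1 // => i; rewrite eq_sym => /negPf->.
by rewrite mem_index_iota lt0n eq_sym r0 ltnS.
Qed.

Lemma leq_sumn r l : r \in l -> (r <= sumn l)%N.
Proof. by move=> rl; rewrite sumnE (big_rem r) //= leq_addr. Qed.

(** A partition of n, padded with zeros to length n, is a tuple with entries at most n; deleting the
    zeros recovers it. Tuples that give no partition go to the empty one. *)
Lemma finite_weight n : finite_set [set la : intpart | weight la = n]%classic.
Proof.
pose f (l : n.-tuple 'I_n.+1) : intpart :=
  insubd (@IntPart [::] isT) [seq r <- map val l | r != 0%N].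
apply: (@sub_finite_set _ _ (f @` [set: n.-tuple 'I_n.+1]%classic)); last first.
  exact/finite_image/finite_finset.
move=> la /= lan; have /andP[s0 z0] := intpart_is_intpart la.
have szn : (size la <= n)%N.
  rewrite -lan /weight; elim: {s0 lan} (parts la) z0 => //= r l IH.
  by rewrite inE negb_or eq_sym -lt0n => /andP[r0 /IH]; lia.
have szt : size (la ++ nseq (n - size la) 0%N) == n.
  by rewrite size_cat size_nseq subnKC.
exists (map_tuple inord (Tuple szt)) => //; apply/val_inj => /=.
rewrite /f val_insubd -map_comp.
have -> : [seq (val \o (@inord n : nat -> 'I_n.+1)) i | i <- la ++ nseq (n - size la) 0%N] =
          la ++ nseq (n - size la) 0%N :> seq nat.
  rewrite -[RHS]map_id; apply/eq_in_map => y.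
  rewrite mem_cat => /orP[yl|/nseqP[-> _]] /=.
    by rewrite inordK // ltnS -lan leq_sumn.
  by rewrite inordK.
have -> : [seq r <- la ++ nseq (n - size la) 0%N | r != 0%N] = la.
  rewrite filter_cat (_ : [seq r <- nseq _ _ | _] = [::]) ?cats0; last first.
    by elim: (n - size la)%N.
  by apply/all_filterP/allP => y yl; apply: contraNneq z0 => <-.
by rewrite -/(is_intpart la) intpart_is_intpart.
Qed.

Definition partitions (n : nat) : seq intpart :=
  fset_set [set la : intpart | weight la = n]%classic.

Lemma mem_partitions n la : (la \in partitions n) = (weight la == n).
Proof.
rewrite /partitions in_fset_set; last exact: finite_weight.
by apply/idP/eqP => [/set_mem|h]; last exact/mem_set.
Qed.

Lemma partitions_uniq n : uniq (partitions n).
Proof. exact: fset_uniq. Qed.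

Section Basis.
Variables (R : realType) (t : R).
Hypothesis t_bnd : -1 < t < 0.

Let t_neq1 : 1 - t != 0.
Proof. by have := one_subXn_neq0 t_bnd (ltn0Sn 0); rewrite expr1. Qed.

Lemma bHL_neq0 la : bHL t la != 0.
Proof.
rewrite /bHL prodf_seq_neq0; apply/allP => i _ /=.
rewrite prodf_seq_neq0; apply/allP => j; rewrite mem_index_iota => /andP[j0 _] /=.
exact: one_subXn_neq0.
Qed.

(** The multiplicities, m_0 included, add up to N, hence N denominators 1 - t. *)
Lemma vHLE N (la : intpart) : (size la <= N)%N ->
  vHL N t la = (1 - t) ^- N * (\prod_(1 <= j < (N - size la).+1) (1 - t ^+ j)) * bHL t la.
Proof.
move=> laN; have /andP[_ z0] := intpart_is_intpart la.
have prodE n : \prod_(1 <= j < n.+1) ((1 - t ^+ j) / (1 - t)) =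
    (1 - t) ^- n * \prod_(1 <= j < n.+1) (1 - t ^+ j).
  by rewrite big_split /= prodr_const_nat subn1 exprVn mulrC.
rewrite /vHL prodE [X in _ * X = _](eq_bigr _ (fun i _ => prodE _)).
rewrite [X in _ * X = _]big_split /= -/(bHL t la).
have -> : \prod_(1 <= i < (weight la).+1) (1 - t) ^- mpart la i = (1 - t) ^- size la.
  under eq_bigr => i _ do rewrite -exprVn.
  rewrite -expr_sum exprVn; congr (_ ^- _); apply: sum_count_mem => //.
  by apply/allP => r rl; apply: leq_sumn.
rewrite -[in RHS](subnK laN) exprD invfM; rewrite subnK //; ring.
Qed.

(** With la padded by zeros to length N, [hl_perm_sum] and [hl_pad0] produce exactly the factors of
    [vHL] other than b. *)
Lemma HLratE N (la : intpart) : (size la <= N)%N ->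
  HLrat N t la = ratC N (bHL t la)^-1 * HLQ t la [set: 'I_N].
Proof.
move=> laN; pose l := la ++ nseq (N - size la) 0%N.
have sl : size l = N by rewrite size_cat size_nseq subnKC.
have := @hl_perm_sum _ _ (@ratX R N) (ratC N t) N id l (@inj_id _) sl.
have -> : [set id i | i : 'I_N] = [set: 'I_N].
  by apply/setP => i; rewrite inE; apply/imsetP; exists i.
rewrite hl_pad0; last 3 first.
- exact: ratX_inj.
- exact: ratX_neq0.
- by rewrite cardsT card_ord subnKC.
have -> : \prod_(1 <= j < (N - size la).+1) (1 - ratC N t ^+ j) =
    ratC N (\prod_(1 <= j < (N - size la).+1) (1 - t ^+ j)).
  by rewrite rmorph_prod; apply: eq_bigr => j _; rewrite rmorphB rmorph1 rmorphXn.
have p0 : \prod_(1 <= j < (N - size la).+1) (1 - t ^+ j) != 0.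
  rewrite prodf_seq_neq0; apply/allP => j; rewrite mem_index_iota => /andP[j0 _] /=.
  exact: one_subXn_neq0.
rewrite /HLrat vHLE //; set S := (X in _ * X = _ -> _); set S' := (X in _ -> _ * X = _).
have -> : S = S'.
  apply: eq_bigr => w _; congr (_ * _); apply: eq_bigr => i _; congr (_ ^+ _).
  rewrite /part /l nth_cat; case: ltnP => // h.
  by rewrite nth_nseq if_same nth_default.
rewrite -(rmorph1 (@ratC R N)) -rmorphB -rmorphXn => E.
have u0 : ratC N ((1 - t) ^+ N) != 0 by rewrite fmorph_eq0 expf_neq0.
apply: (mulfI u0); rewrite mulrCA E [in RHS]mulrCA !mulrA -!rmorphM; congr (_ * _).
congr (ratC N _); rewrite !invfM invrK; have := bHL_neq0 la => b0.
by field; rewrite b0 p0.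
Qed.

Lemma powers_expand : exists A : intpart -> intpart -> R, forall (la : intpart) N,
  tofrac (spec N (pmon R la)) =
  \sum_(mu <- partitions (weight la)) ratC N (A la mu) * HLQ t mu [set: 'I_N].
Proof.
suff /choice[A hA] : forall la : intpart, exists a : intpart -> R, forall N,
    tofrac (spec N (pmon R la)) =
    \sum_(mu <- partitions (weight la)) ratC N (a mu) * HLQ t mu [set: 'I_N].
  by exists A.
move=> la; have /andP[_ z0] := intpart_is_intpart la.
have [cs csP csE] := stable_powers t_bnd z0.
(* [cs] may list a partition several times. *)
exists (fun mu => \sum_(c <- cs | c.2 == parts mu) c.1) => N.
have -> : tofrac (spec N (pmon R la)) = \prod_(r <- la) pown R r [set: 'I_N].
  rewrite spec_pmon // rmorph_prod; apply: eq_bigr => r _.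
  exact: tofrac_xpow.
rewrite csE; under [RHS]eq_bigr => mu _ do rewrite rmorph_sum mulr_suml.
rewrite [RHS](exchange_big_dep predT) //=.
apply: eq_big_seq => c /(allP csP)/andP[ci /eqP cw].
pose nu := IntPart ci.
have nus : nu \in partitions (weight la) by rewrite mem_partitions /weight /= cw.
rewrite big_mkcond (bigD1_seq nu) ?partitions_uniq //=.
rewrite eqxx big1 ?addr0 // => mu; rewrite eq_sym => mnu; case: eqP => // e.
by case/eqP: mnu; apply: val_inj.
Qed.

Lemma mcoeff_sum_pmon (s : seq intpart) (c : intpart -> R) la : uniq s -> la \in s ->
  monalg.mcoeff (cmon la) (\sum_(mu <- s) c mu *: pmon R mu) = c la.
Proof.
move=> us las; rewrite raddf_sum (bigD1_seq la) //= big1 ?addr0.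
  by rewrite pmonE monalg.mcoeffZ mcoeffUU mulr1.
move=> mu mula; rewrite pmonE monalg.mcoeffZ mcoeffU.
case: eqP => [e|_]; last by rewrite mulr0.
case/eqP: mula; apply: val_inj; rewrite /= -(cmonK (intpart_is_intpart mu)) e.
exact/cmonK/intpart_is_intpart.
Qed.

Lemma tofrac_specZ N c (f : SymF R) : tofrac (spec N (c *: f)) = ratC N c * tofrac (spec N f).
Proof. by rewrite specZ rmorphM. Qed.

Lemma tofrac_spec_sum N (I : Type) (s : seq I) (c : I -> R) (f : I -> SymF R) :
  tofrac (spec N (\sum_(i <- s) c i *: f i)) =
  \sum_(i <- s) ratC N (c i) * tofrac (spec N (f i)).
Proof.
rewrite (raddf_sum (@spec R N)) raddf_sum; apply: eq_bigr => i _.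
exact: tofrac_specZ.
Qed.

(* The matrix A expressing the products of power sums of weight n in terms of
   the Q_mu is square, and it is invertible because the former are linearly
   independent; this gives the existence and the independence of the Q_mu. *)
Lemma HL_basis n : exists F : intpart -> SymF R,
  (forall mu N, weight mu = n -> tofrac (spec N (F mu)) = HLQ t mu [set: 'I_N]) /\
  (forall c : intpart -> R, \sum_(mu <- partitions n) c mu *: F mu = 0 ->
     forall mu, weight mu = n -> c mu = 0).
Proof.
have [A hA] := powers_expand; pose s := partitions n; pose k := size s.
pose e0 : intpart := IntPart (parts := [::]) isT.
pose p (i : 'I_k) := nth e0 s i.
have ps i : p i \in s by exact: mem_nth.
have pw i : weight (p i) = n by apply/eqP; rewrite -mem_partitions ps.
have sumE (V : nmodType) (G : intpart -> V) : \sum_(mu <- s) G mu = \sum_(i < k) G (p i).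
  by rewrite (big_nth e0) big_mkord.
have p_inj : injective p.
  by move=> i j /eqP; rewrite nth_uniq ?partitions_uniq // => /eqP/val_inj.
pose M : 'M[R]_k := \matrix_(i, j) A (p i) (p j).
have specp N i : tofrac (spec N (pmon R (p i))) =
    \sum_j ratC N (M i j) * HLQ t (p j) [set: 'I_N].
  by rewrite hA pw sumE; apply: eq_bigr => j _; rewrite mxE.
have pfree (u : 'rV[R]_k) : \sum_i u 0 i *: pmon R (p i) = 0 -> u = 0.
  move=> u0; apply/rowP => i; rewrite mxE.
  pose c mu := \sum_(j < k | p j == mu) u 0 j.
  have cp j : c (p j) = u 0 j.
    by rewrite /c (big_pred1 j) // => j'; rewrite (inj_eq p_inj).
  rewrite -cp -(@mcoeff_sum_pmon s c (p i)) ?partitions_uniq // sumE.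
  under eq_bigr => j _ do rewrite cp.
  by rewrite u0 monalg.mcoeff0.
have Mu : M \in unitmx.
  (* A row vector killed by M would be a relation between products of power sums in every number of
     variables, hence in Sym. *)
  rewrite unitmxE unitfE; apply/det0P => -[v v0 vM]; case/eqP: v0; apply: pfree.
  apply: (@spec_inj _ _ 0) => N _; apply/eqP; rewrite -tofrac_eq0; apply/eqP.
  rewrite tofrac_spec_sum.
  under eq_bigr => i _ do rewrite specp mulr_sumr.
  rewrite exchange_big big1 //= => j _.
  under eq_bigr => i _ do rewrite mulrA -rmorphM.
  rewrite -mulr_suml -rmorph_sum.
  have -> : \sum_i v 0 i * M i j = (v *m M) 0 j by rewrite mxE.
  by rewrite vM mxE rmorph0 mul0r.
pose G (j : 'I_k) : SymF R := \sum_i invmx M j i *: pmon R (p i).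
pose F mu := \sum_(j | p j == mu) G j.
have FE j : F (p j) = G j.
  by rewrite /F (big_pred1 j) // => j'; rewrite (inj_eq p_inj).
have memp mu : weight mu = n -> exists j, mu = p j.
  move=> /eqP; rewrite -mem_partitions => mus.
  have h : (index mu s < k)%N by rewrite index_mem.
  by exists (Ordinal h); rewrite /p nth_index.
exists F; split=> [mu N /memp[j ->]|c c0 mu /memp[j ->]].
  rewrite FE /G tofrac_spec_sum.
  under eq_bigr => i _ do rewrite specp mulr_sumr.
  rewrite exchange_big (bigD1 j) //= [X in _ + X]big1 ?addr0.
    under eq_bigr => i _ do rewrite mulrA -rmorphM.
    rewrite -mulr_suml -rmorph_sum.
    have -> : \sum_i invmx M j i * M i j = (invmx M *m M) j j by rewrite mxE.
    by rewrite mulVmx // mxE eqxx rmorph1 mul1r.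
  move=> l lj; under eq_bigr => i _ do rewrite mulrA -rmorphM.
  rewrite -mulr_suml -rmorph_sum.
  have -> : \sum_i invmx M j i * M i l = (invmx M *m M) j l by rewrite mxE.
  by rewrite mulVmx // mxE eq_sym (negPf lj) rmorph0 mul0r.
pose u : 'rV[R]_k := \row_j c (p j).
suff: u = 0 by move/rowP/(_ j); rewrite !mxE.
have -> : u = u *m invmx M *m M by rewrite mulmxKV.
(* u M^(-1) is the coefficient vector of the given relation rewritten in products of power sums. *)
suff -> : u *m invmx M = 0 by rewrite !mul0mx.
apply: pfree; rewrite -[RHS]c0 sumE.
under [RHS]eq_bigr => i _ do rewrite FE scaler_sumr.
rewrite exchange_big; apply: eq_bigr => i _ /=.
rewrite mxE scaler_suml; apply: eq_bigr => l _.
by rewrite mxE scalerA.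
Qed.

(** By [spec_inj] the specializations in N >= l(la) variables determine an element, so [xget] can
    only return f. *)
Lemma HL_P_HLratE (la : intpart) (f : SymF R) :
  (forall N, (size la <= N)%N -> tofrac (spec N f) = HLrat N t la) -> HL_P t la = f.
Proof.
move=> hf; rewrite /HL_P; case: xgetP => [g _ /= hg|/(_ f)]; last by case.
apply/eqP; rewrite -subr_eq0; apply/eqP; apply: (@spec_inj _ _ (size la)) => N hN.
by apply/eqP; rewrite -tofrac_eq0 !rmorphB /= hf // hg // subrr.
Qed.

Lemma HL_Q_basisE n (F : intpart -> SymF R) :
  (forall mu N, weight mu = n -> tofrac (spec N (F mu)) = HLQ t mu [set: 'I_N]) ->
  forall mu, weight mu = n -> HL_Q t mu = F mu.
Proof.
move=> hF mu muw; rewrite /HL_Q (@HL_P_HLratE _ ((bHL t mu)^-1 *: F mu)).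
  by rewrite scalerA mulfV ?scale1r // bHL_neq0.
by move=> N hN; rewrite tofrac_specZ hF // HLratE.
Qed.

Lemma tofrac_spec_HL_Q N mu : tofrac (spec N (HL_Q t mu)) = HLQ t mu [set: 'I_N].
Proof.
by have [F [hF _]] := HL_basis (weight mu); rewrite (HL_Q_basisE hF) // hF.
Qed.

Lemma HL_Q_free n (c : intpart -> R) :
  \sum_(mu <- partitions n) c mu *: HL_Q t mu = 0 -> forall mu, weight mu = n -> c mu = 0.
Proof.
have [F [hF free]] := HL_basis n => c0; apply: free; rewrite -[RHS]c0.
apply: eq_big_seq => mu; rewrite mem_partitions => /eqP muw.
by rewrite (HL_Q_basisE hF).
Qed.

End Basis.

(** * Columns of Young diagrams *)

(** For j > 0, the length of column j, that is, a part of the conjugate partition. *)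
Definition colsize (l : seq nat) (j : nat) : nat := count (leq j) l.

Lemma colsizeP l i j : sorted geq l -> (0 < j)%N -> (j <= nth 0%N l i)%N = (i < colsize l j)%N.
Proof.
move=> + j0; elim: l i => [|a l IH] i; first by rewrite nth_nil leqn0 gtn_eqF.
rewrite sorted_geq_cons => /andP[la /IH {}IH]; rewrite /colsize /=.
have [ja|aj] := leqP j a; first by case: i => //= i; rewrite IH.
have -> : count (leq j) l = 0%N.
  apply/eqP; rewrite -leqn0 leqNgt -has_count; apply/hasPn => y /(allP la).
  by rewrite /geq /= -ltnNge => /leq_ltn_trans; apply.
case: i => [|i] /=; first by rewrite leqNgt aj.
apply/negbTE; rewrite -ltnNge; case: (ltnP i (size l)) => il; last by rewrite nth_default.
by have := allP la _ (mem_nth 0%N il); rewrite /geq /= => /leq_ltn_trans; apply.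
Qed.

Lemma sum_leq_nat W a : (a <= W)%N -> (\sum_(1 <= j < W.+1) (j <= a) = a)%N.
Proof.
move=> aW; rewrite (@big_cat_nat _ _ _ a.+1) //= [X in (_ + X)%N]big_nat_cond.
rewrite [X in (_ + X)%N]big1 ?addn0; last first.
  by move=> j /andP[/andP[aj _] _]; rewrite leqNgt aj.
rewrite big_nat_cond (eq_bigr (fun=> 1%N)); last first.
  by move=> j /andP[/andP[_ ja] _]; rewrite -ltnS ja.
by rewrite -big_nat_cond sum_nat_const_nat muln1 subn1.
Qed.

Lemma sum_colsize W l : all (geq W) l -> (\sum_(1 <= j < W.+1) colsize l j = sumn l)%N.
Proof.
elim: l => [|a l IH] /=; first by rewrite big1.
by move=> /andP[aW lW]; rewrite big_split /= IH // sum_leq_nat.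
Qed.

Lemma colsize_count l j : colsize l j = (count_mem j l + colsize l j.+1)%N.
Proof.
elim: l => //= a l; rewrite /colsize /= => ->.
by rewrite [(j <= a)%N]leq_eqVlt; case: ltngtP; lia.
Qed.

Lemma colsize_eq l1 l2 : is_intpart l1 -> is_intpart l2 ->
  (forall j, (0 < j)%N -> colsize l1 j = colsize l2 j) -> l1 = l2.
Proof.
move=> h1 h2 h; apply: is_intpart_eq => // i; apply/eqP.
by rewrite -(eqn_add2r (colsize l1 i.+2)) -colsize_count h // h // -colsize_count.
Qed.

Lemma colsize_anti l i j : (i <= j)%N -> (colsize l j <= colsize l i)%N.
Proof. by move=> ij; apply: sub_count => y; apply: leq_trans. Qed.

Lemma count_rem (p : pred nat) s l : s \in l -> (count p (rem s l) + p s = count p l)%N.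
Proof.
by move=> sl; rewrite (seq.permP (perm_to_rem sl)) /= addnC.
Qed.

Lemma count_mem_gt1 s (l : seq nat) : (1 < count_mem s l)%N -> s \in l /\ s \in rem s l.
Proof.
move=> c1; have sl : s \in l by rewrite -has_pred1 has_count ltnW.
split=> //; rewrite -has_pred1 has_count -(ltn_add2r (pred1 s s)) count_rem //.
by rewrite /= eqxx.
Qed.

(** Whether enough parts s are present, zeros being inexhaustible. Where this fails, [coef2] or
    [coef11] vanishes. *)
Definition addable2 (s : nat) (l : seq nat) : bool := (s == 0%N) || (s \in l).

Definition addable11 (s : nat) (l : seq nat) : bool :=
  (s == 0%N) || (1 < count_mem s l)%N.

Lemma colsize_up2 s l j : is_intpart l -> addable2 s l -> (0 < j)%N ->
  colsize (up2 s l) j = (colsize l j + (j == s.+1) + (j == s.+2))%N.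
Proof.
move=> /andP[_ l0] sl j0; rewrite /colsize /up2 (seq.permP (permEl (perm_sort _ _))) /=.
case/orP: sl => [/eqP->|sl]; first by rewrite rem_id //; lia.
by have := count_rem (leq j) sl; lia.
Qed.

Lemma colsize_up11 s l j : is_intpart l -> addable11 s l -> (0 < j)%N ->
  colsize (up11 s l) j = (colsize l j + (j == s.+1).*2)%N.
Proof.
move=> /andP[_ l0] sl j0; rewrite /colsize /up11 (seq.permP (permEl (perm_sort _ _))) /=.
case/orP: sl => [/eqP->|sl]; first by rewrite !rem_id //; lia.
have [sl1 sl2] := count_mem_gt1 sl.
by have := count_rem (leq j) sl1; have := count_rem (leq j) sl2; lia.
Qed.

Lemma up2_is_intpart s l : is_intpart l -> is_intpart (up2 s l).
Proof.
move=> /andP[_ l0]; rewrite /is_intpart sort_sorted; last by move=> p q; apply: leq_total.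
by rewrite mem_sort inE /=; apply: contra l0 => /mem_rem.
Qed.

Lemma up11_is_intpart s l : is_intpart l -> is_intpart (up11 s l).
Proof.
move=> /andP[_ l0]; rewrite /is_intpart sort_sorted; last by move=> p q; apply: leq_total.
by rewrite mem_sort !inE /=; apply: contra l0 => /mem_rem/mem_rem.
Qed.

Lemma sumn_up2 s l : addable2 s l -> 0%N \notin l -> sumn (up2 s l) = (sumn l + 2)%N.
Proof.
move=> sl l0; rewrite (perm_sumn (permEl (perm_sort _ _))) /=.
case/orP: sl => [/eqP->|sl]; first by rewrite rem_id //; lia.
by have /= := perm_sumn (perm_to_rem sl); lia.
Qed.

Lemma sumn_up11 s l : addable11 s l -> 0%N \notin l -> sumn (up11 s l) = (sumn l + 2)%N.
Proof.
move=> sl l0; rewrite (perm_sumn (permEl (perm_sort _ _))) /=.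
case/orP: sl => [/eqP->|sl]; first by rewrite !rem_id //; lia.
have [sl1 sl2] := count_mem_gt1 sl.
by have /= := perm_sumn (perm_to_rem sl1); have /= := perm_sumn (perm_to_rem sl2); lia.
Qed.

Definition up2p (s : nat) (mu : intpart) : intpart :=
  IntPart (up2_is_intpart s (intpart_is_intpart mu)).

Definition up11p (s : nat) (mu : intpart) : intpart :=
  IntPart (up11_is_intpart s (intpart_is_intpart mu)).

Lemma all_geq_sumn (l : seq nat) W : (sumn l <= W)%N -> all (geq W) l.
Proof. by move=> lW; apply/allP => r /leq_sumn rl; apply: leq_trans rl lW. Qed.

(** Double count of the boxes weighted by their rows; this is the formula for n(la) as the sum of
    the binomials (la'_j choose 2). Any large [W] is allowed, so that two partitions can share the
    range. *)
Lemma nstat_colsize W (la : intpart) : (weight la <= W)%N ->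
  nstat la = (\sum_(1 <= j < W.+1) \sum_(i < colsize la j) i)%N.
Proof.
move=> laW; have /andP[sl _] := intpart_is_intpart la.
have pW i : (part la i <= W)%N.
  have [il|il] := ltnP i (size la); last by rewrite /part nth_default.
  exact: leq_trans (leq_sumn (mem_nth _ il)) laW.
transitivity (\sum_(i < size la) \sum_(1 <= j < W.+1) i * (j <= part la i))%N.
  by apply: eq_bigr => i _; rewrite -big_distrr /= sum_leq_nat.
rewrite exchange_big; apply: eq_big_nat => j /andP[j0 _].
have cl : (colsize la j <= size la)%N by apply: count_size.
rewrite [RHS](big_ord_widen _ (fun i => i) cl) [RHS]big_mkcond.
by apply: eq_bigr => i _; rewrite colsizeP //; case: ltnP; rewrite ?muln1 ?muln0.
Qed.

Lemma nstat_eq_sum (la mu : intpart) (d : nat -> nat) W :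
  (weight la <= W)%N -> (weight mu <= W)%N ->
  (forall j, (0 < j)%N -> colsize la j = (colsize mu j + d j)%N) ->
  nstat la = (nstat mu +
    \sum_(1 <= j < W.+1) \sum_(0 <= i < d j) (colsize mu j + i))%N.
Proof.
move=> laW muW h; rewrite (nstat_colsize laW) (nstat_colsize muW) -big_split /=.
apply: eq_big_nat => j /andP[j0 _]; rewrite h // -!(big_mkord predT id).
rewrite (@big_cat_nat _ _ _ (colsize mu j)) ?leq_addr //=; congr addn.
by rewrite -{1}[colsize mu j]add0n big_addn addKn; apply: eq_bigr => i _; rewrite addnC.
Qed.

Lemma sum_nat_eq W a c : (0 < a <= W)%N -> (\sum_(1 <= j < W.+1) (j == a) * c = c)%N.
Proof.
move=> aW; rewrite (bigD1_seq a) ?iota_uniq ?mem_index_iota ?ltnS //=.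
by rewrite eqxx mul1n big1 ?addn0 // => j /negPf->.
Qed.

(** The new boxes lie in rows mu'_(s+1) and mu'_(s+2), counted from 0, and mu'_(s+1) - mu'_(s+2) =
    m_(s+1). *)
Lemma sign_up2p (R : realType) s (mu : intpart) : addable2 s mu ->
  (-1) ^+ nstat mu * (-1) ^+ nstat (up2p s mu) = (-1) ^+ mpart mu s.+1 :> R.
Proof.
move=> sl; have il := intpart_is_intpart mu; have /andP[_ l0] := il.
have w : weight (up2p s mu) = (weight mu + 2)%N by apply: sumn_up2.
pose W := (weight mu + s + 2)%N.
rewrite (@nstat_eq_sum (up2p s mu) mu (fun j => (j == s.+1) + (j == s.+2))%N W); first last.
- by move=> j j0; rewrite colsize_up2 // addnA.
- by rewrite /W; lia.
- by rewrite w /W; lia.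
have -> : (\sum_(1 <= j < W.+1) \sum_(0 <= i < (j == s.+1) + (j == s.+2))
    (colsize mu j + i) = colsize mu s.+1 + colsize mu s.+2)%N.
  rewrite -(@sum_nat_eq W s.+1 (colsize mu s.+1)); last by rewrite /W; lia.
  rewrite -(@sum_nat_eq W s.+2 (colsize mu s.+2)); last by rewrite /W; lia.
  rewrite -big_split; apply: eq_bigr => j _ /=.
  have [->|n1] := eqVneq j s.+1.
    by rewrite (_ : (s.+1 == s.+2) = false) /= ?big_nat1 ?mul1n ?mul0n ?addn0 //; lia.
  have [->|n2] := eqVneq j s.+2; first by rewrite big_nat1 mul1n mul0n addn0 add0n.
  by rewrite big_geq.
rewrite (colsize_count mu s.+1) -/(mpart mu s.+1).
rewrite -addnA addnn exprD mulrA -expr2 sqrr_sign mul1r.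
by rewrite exprD -mul2n exprM sqrrN expr1n expr1n mulr1.
Qed.

(** Two boxes stacked in one column have consecutive row numbers, whose sum is odd. *)
Lemma sign_up11p (R : realType) s (mu : intpart) : addable11 s mu ->
  (-1) ^+ nstat mu * (-1) ^+ nstat (up11p s mu) = -1 :> R.
Proof.
move=> sl; have il := intpart_is_intpart mu; have /andP[_ l0] := il.
have w : weight (up11p s mu) = (weight mu + 2)%N by apply: sumn_up11.
pose W := (weight mu + s + 2)%N.
rewrite (@nstat_eq_sum (up11p s mu) mu (fun j => (j == s.+1).*2)%N W); first last.
- by move=> j j0; rewrite colsize_up11.
- by rewrite /W; lia.
- by rewrite w /W; lia.
have -> : (\sum_(1 <= j < W.+1) \sum_(0 <= i < (j == s.+1).*2)
    (colsize mu j + i) = (colsize mu s.+1).*2.+1)%N.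
  rewrite -(@sum_nat_eq W s.+1 (colsize mu s.+1).*2.+1); last by rewrite /W; lia.
  apply: eq_bigr => j _ /=.
  have [->|n1] := eqVneq j s.+1; last by rewrite big_geq.
  by rewrite big_nat_recr //= big_nat1 mul1n; lia.
rewrite exprD mulrA -expr2 sqrr_sign mul1r exprS -mul2n exprM sqrrN expr1n expr1n.
by rewrite mulr1.
Qed.

Lemma skew_columnsP (la mu : intpart) j :
  skew_columns la mu j <-> (0 < j)%N /\ (colsize mu j < colsize la j)%N.
Proof.
have /andP[sl _] := intpart_is_intpart la; have /andP[sm _] := intpart_is_intpart mu.
split=> [[i /andP[h1 h2]]|[j0 h]].
  have j0 : (0 < j)%N by apply: leq_ltn_trans h1.
  split=> //; move: h2; rewrite colsizeP //; apply: leq_ltn_trans.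
  by rewrite leqNgt -colsizeP // -ltnNge.
(* The first row in which column j leaves mu. *)
by exists (colsize mu j); rewrite ltnNge /part !colsizeP // ltnn h.
Qed.

Lemma subdiagramP (mu la : intpart) :
  subdiagram mu la <-> forall j, (0 < j)%N -> (colsize mu j <= colsize la j)%N.
Proof.
have /andP[sl _] := intpart_is_intpart la; have /andP[sm _] := intpart_is_intpart mu.
split=> [h j j0|h i].
  rewrite leqNgt -colsizeP //; apply/negP => /leq_trans/(_ (h _)).
  by rewrite /part colsizeP // ltnn.
have [->//|p0] := posnP (part mu i).
by rewrite /part colsizeP // (leq_trans _ (h _ p0)) // -colsizeP.
Qed.

Lemma gap_sum2 W (f g : nat -> nat) :
  (\sum_(1 <= j < W.+1) f j = \sum_(1 <= j < W.+1) g j + 2)%N ->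
  (forall j, (0 < j)%N -> (g j <= f j)%N) ->
  (\sum_(1 <= j < W.+1) (f j - g j) = 2)%N.
Proof.
move=> e le; apply/eqP; rewrite -(eqn_add2l (\sum_(1 <= j < W.+1) g j)) -e -big_split.
by apply/eqP; apply: eq_big_nat => j /andP[j0 _] /=; rewrite subnKC // le.
Qed.

Lemma arrow_gap (mu la : intpart) : weight la = (weight mu + 2)%N -> subdiagram mu la ->
  (\sum_(1 <= j < (weight la).+1) (colsize la j - colsize mu j) = 2)%N.
Proof.
move=> w /subdiagramP le; apply: gap_sum2 => //.
by rewrite !sum_colsize ?all_geq_sumn // -?/(weight _) w ?leq_addr.
Qed.

Lemma colsize_gt_weight (la : intpart) j : (0 < colsize la j)%N -> (j <= weight la)%N.
Proof. by rewrite -has_count => /hasP[y yl /leq_trans]; apply; apply: leq_sumn. Qed.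

Lemma skewN (mu la : intpart) j : subdiagram mu la -> (0 < j)%N ->
  ~ skew_columns la mu j -> colsize la j = colsize mu j.
Proof.
move=> /subdiagramP le j0 sk; apply/eqP; rewrite eqn_leq le // andbT leqNgt.
by apply/negP => h; apply: sk; apply/skew_columnsP.
Qed.

Lemma colsize_single (mu la : intpart) k : weight la = (weight mu + 2)%N ->
  subdiagram mu la -> in_single_column la mu k -> (0 < k)%N /\
  forall j, (0 < j)%N -> colsize la j = (colsize mu j + (j == k).*2)%N.
Proof.
move=> w sub sk.
have [k0 kk] : (0 < k)%N /\ (colsize mu k < colsize la k)%N.
  by apply/skew_columnsP; rewrite sk.
have nk j : (0 < j)%N -> j != k -> colsize la j = colsize mu j.
  by move=> j0 jk; apply: skewN => //; rewrite sk /= => /eqP; rewrite (negPf jk).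
split=> // j j0; have [->|jk] := eqVneq j k; last by rewrite nk ?addn0.
have kw : (k <= weight la)%N by apply/colsize_gt_weight/(leq_ltn_trans _ kk).
have := arrow_gap w sub; rewrite (bigD1_seq k) ?iota_uniq ?mem_index_iota ?k0 //=.
rewrite big_seq_cond big1; first by lia.
by move=> i /andP[]; rewrite mem_index_iota => /andP[i0 _] ik; rewrite nk ?subnn.
Qed.

(** Each of the two columns receives at least one box and there are two boxes in all. *)
Lemma colsize_two (mu la : intpart) k : weight la = (weight mu + 2)%N ->
  subdiagram mu la -> in_two_columns la mu k -> (0 < k)%N /\
  forall j, (0 < j)%N -> colsize la j = (colsize mu j + (j == k) + (j == k.+1))%N.
Proof.
move=> w sub sk.
have [k0 kk] : (0 < k)%N /\ (colsize mu k < colsize la k)%N.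
  by apply/skew_columnsP; rewrite sk; left.
have [_ kk1] : (0 < k.+1)%N /\ (colsize mu k.+1 < colsize la k.+1)%N.
  by apply/skew_columnsP; rewrite sk; right.
have nk j : (0 < j)%N -> j != k -> j != k.+1 -> colsize la j = colsize mu j.
  by move=> j0 jk jk1; apply: skewN => //; rewrite sk /= => -[]/eqP; rewrite ?(negPf jk) ?(negPf jk1).
have kw : (k.+1 <= weight la)%N by apply/colsize_gt_weight/(leq_ltn_trans _ kk1).
have gap : (colsize la k - colsize mu k + (colsize la k.+1 - colsize mu k.+1) = 2)%N.
  rewrite -[RHS](arrow_gap w sub) -(@sum_nat_eq (weight la) k (colsize la k - colsize mu k)).
    rewrite -(@sum_nat_eq (weight la) k.+1 (colsize la k.+1 - colsize mu k.+1)) //.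
    rewrite -big_split; apply: eq_big_nat => j /andP[j0 _] /=.
    have [->|jk] := eqVneq j k; first by rewrite ltn_eqF // mul1n addn0.
    have [->|jk1] := eqVneq j k.+1; first by rewrite mul1n.
    by rewrite (nk j) // subnn.
  by rewrite k0 ltnW.
split=> // j j0; have [->|jk] := eqVneq j k; first by rewrite ltn_eqF //; lia.
have [->|jk1] := eqVneq j k.+1; first by lia.
by rewrite (nk j) // !addn0.
Qed.

(** With s = k - 1 > 0, the columns of la must not increase: mu'_(s+1) + 2 <= mu'_s, that is,
    m_s(mu) >= 2. Equal column lengths then identify la. In [two_up2p] the same argument gives
    m_s(mu) >= 1. *)
Lemma single_up11p (mu la : intpart) k : weight la = (weight mu + 2)%N ->
  subdiagram mu la -> in_single_column la mu k ->
  (0 < k)%N /\ addable11 k.-1 mu /\ la = up11p k.-1 mu.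
Proof.
move=> w sub sk; have [k0 cs] := colsize_single w sub sk; case: k k0 sk cs => // k _ sk cs.
split=> //=; have ad : addable11 k mu.
  case: k {sk} cs => [//|k] cs; rewrite /addable11 /=.
  have := colsize_anti la (leqnSn k.+1); rewrite !cs // eqxx ltn_eqF // addn0.
  by rewrite (colsize_count mu k.+1) addnC leq_add2r.
split=> //; apply: val_inj; apply: colsize_eq; rewrite ?intpart_is_intpart //.
by move=> j j0; rewrite cs // colsize_up11 // intpart_is_intpart.
Qed.

Lemma two_up2p (mu la : intpart) k : weight la = (weight mu + 2)%N ->
  subdiagram mu la -> in_two_columns la mu k ->
  (0 < k)%N /\ addable2 k.-1 mu /\ la = up2p k.-1 mu.
Proof.
move=> w sub sk; have [k0 cs] := colsize_two w sub sk; case: k k0 sk cs => // k _ sk cs.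
split=> //=; have ad : addable2 k mu.
  case: k {sk} cs => [//|k] cs; rewrite /addable2 /= -has_pred1 has_count.
  have := colsize_anti la (leqnSn k.+1); rewrite !cs // eqxx !ltn_eqF // !addn0.
  by rewrite (colsize_count mu k.+1); lia.
split=> //; apply: val_inj; apply: colsize_eq; rewrite ?intpart_is_intpart //.
by move=> j j0; rewrite cs // colsize_up2 // intpart_is_intpart.
Qed.

Lemma up2p_arrow (mu : intpart) s : addable2 s mu ->
  two_box_arrow mu (up2p s mu) /\ in_two_columns (up2p s mu) mu s.+1.
Proof.
move=> ad; have il := intpart_is_intpart mu; have /andP[_ l0] := il.
have cs j : (0 < j)%N -> colsize (up2p s mu) j = _ := colsize_up2 il ad.
have sk : in_two_columns (up2p s mu) mu s.+1.
  apply/seteqP; split=> j.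
    move/skew_columnsP => [j0]; rewrite cs //.
    have [->|_] := eqVneq j s.+1; first by left.
    have [->|_] := eqVneq j s.+2; first by right.
    by rewrite !addn0 ltnn.
  move=> h; apply/skew_columnsP; have j0 : (0 < j)%N by case: h => ->.
  by split=> //; rewrite cs //; case: h => ->; rewrite eqxx; lia.
split=> //; split; first exact: sumn_up2.
  by apply/subdiagramP => j j0; rewrite cs // -addnA leq_addr.
by exists s.+1; right.
Qed.

Lemma up11p_arrow (mu : intpart) s : addable11 s mu ->
  two_box_arrow mu (up11p s mu) /\ in_single_column (up11p s mu) mu s.+1.
Proof.
move=> ad; have il := intpart_is_intpart mu; have /andP[_ l0] := il.
have cs j : (0 < j)%N -> colsize (up11p s mu) j = _ := colsize_up11 il ad.
have sk : in_single_column (up11p s mu) mu s.+1.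
  apply/seteqP; split=> j.
    move/skew_columnsP => [j0]; rewrite cs //.
    by have [->//|_] := eqVneq j s.+1; rewrite addn0 ltnn.
  by move=> ->; apply/skew_columnsP; rewrite cs // eqxx; split=> //; lia.
split=> //; split; first exact: sumn_up11.
  by apply/subdiagramP => j j0; rewrite cs // leq_addr.
by exists s.+1; left.
Qed.

Lemma two_not_single (la mu : intpart) j k :
  in_two_columns la mu j -> in_single_column la mu k -> False.
Proof.
move=> h1 h2.
have /= e1 : [set k]%classic j by rewrite -h2 h1; left.
have /= e2 : [set k]%classic j.+1 by rewrite -h2 h1; right.
lia.
Qed.

Lemma single_inj (la mu : intpart) j k :
  in_single_column la mu j -> in_single_column la mu k -> j = k.
Proof. by move=> h1 h2; have : [set k]%classic j by rewrite -h2 h1. Qed.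

Lemma two_inj (la mu : intpart) j k :
  in_two_columns la mu j -> in_two_columns la mu k -> j = k.
Proof.
move=> h1 h2.
have [//|e1] : [set k; k.+1]%classic j by rewrite -h2 h1; left.
have [e2|/succn_inj//] : [set k; k.+1]%classic j.+1 by rewrite -h2 h1; right.
by move: e1 e2 => /= -> /=; lia.
Qed.

(** * The expansion coefficients *)

Section Expansion.
Variables (R : realType) (t : R).
Hypothesis t_bnd : -1 < t < 0.

Lemma ratC_coef2 N s l : ratC N (coef2 t s l) = coef2 (ratC N t) s l.
Proof.
rewrite /coef2 /tmult !rmorphM rmorphD rmorphB rmorphXn rmorph1.
by case: (s == 0%N); rewrite ?rmorph0 ?rmorphXn.
Qed.

Lemma ratC_coef11 N s l : ratC N (coef11 t s l) = coef11 (ratC N t) s l.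
Proof.
rewrite /coef11 /tmult /tmult1 rmorphM !rmorphB rmorph1.
by case: (s == 0%N); rewrite ?rmorph0 ?rmorphXn.
Qed.

Lemma tofrac_specM N (f g : SymF R) :
  tofrac (spec N (f * g)) = tofrac (spec N f) * tofrac (spec N g).
Proof. by rewrite (rmorphM (@spec R N)) tofracM. Qed.

Lemma tofrac_specZM N (c : R) (f g : SymF R) : tofrac (spec N ((c *: f) * g)) =
  ratC N c * tofrac (spec N f) * tofrac (spec N g).
Proof.
by transitivity (tofrac (spec N (c *: f)) * tofrac (spec N g));
  [exact: tofrac_specM | rewrite tofrac_specZ].
Qed.

Lemma tofrac_specB N (f g : SymF R) :
  tofrac (spec N (f - g)) = tofrac (spec N f) - tofrac (spec N g).
Proof. by rewrite (rmorphB (@spec R N)) tofracB. Qed.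

Lemma tofrac_spec_inj (f g : SymF R) :
  (forall N, tofrac (spec N f) = tofrac (spec N g)) -> f = g.
Proof.
move=> fg; apply/eqP; rewrite -subr_eq0; apply/eqP; apply: (@spec_inj _ _ 0) => N _.
by apply/eqP; rewrite -tofrac_eq0 tofrac_specB fg subrr.
Qed.

Lemma psum2_HL_Q (mu : intpart) :
  ((1 - t ^+ 2) *: psum R 2) * HL_Q t mu =
  \sum_(s < (weight mu).+1) coef2 t s mu *: HL_Q t (up2p s mu) -
  \sum_(s < (weight mu).+1) coef11 t s mu *: HL_Q t (up11p s mu).
Proof.
apply: tofrac_spec_inj => N.
rewrite tofrac_specZM (spec_psum R N (k := 2)) // tofrac_xpow tofrac_spec_HL_Q //.
have /andP[sl l0] := intpart_is_intpart mu.
rewrite rmorphB rmorph1 rmorphXn.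
rewrite (@power2_hl _ _ _ _ (@ratX_inj R N) (@ratX_neq0 R N) (XFrac_two_neq0 R N) (weight mu).+1) //.
  rewrite /term2 sumrB; apply/esym.
  transitivity (tofrac (spec N (\sum_(s < (weight mu).+1) coef2 t s mu *: HL_Q t (up2p s mu))) -
    tofrac (spec N (\sum_(s < (weight mu).+1) coef11 t s mu *: HL_Q t (up11p s mu)))).
    exact: tofrac_specB.
  congr (_ - _); rewrite tofrac_spec_sum; apply: eq_bigr => s _.
    by rewrite ratC_coef2 tofrac_spec_HL_Q.
  by rewrite ratC_coef11 tofrac_spec_HL_Q.
by apply/allP => r /leq_sumn; rewrite /= ltnS.
Qed.

Definition xi2 (mu : intpart) s : R :=
  (- t) ^+ mpart mu s.+1 * (1 + t) * (1 - tmult t s mu).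

(** When s is not addable, [up2p] or [up11p] has the wrong weight, but its coefficient is 0. *)
Definition xi_val (mu la : intpart) : R :=
  \sum_(s < (weight mu).+1) ((la == up2p s mu)%:R * xi2 mu s +
                             (la == up11p s mu)%:R * coef11 t s mu).

Lemma xi2_eq0 (mu : intpart) s : ~~ addable2 s mu -> xi2 mu s = 0.
Proof.
rewrite negb_or => /andP[/negPf s0 sl]; rewrite /xi2 /tmult s0.
by rewrite (count_memPn sl) subrr mulr0.
Qed.

Lemma coef2_eq0 s l : ~~ addable2 s l -> coef2 t s l = 0.
Proof. by rewrite negb_or -lt0n => /andP[s0 sl]; apply: coef2_0. Qed.

Lemma coef11_eq0 s l : ~~ addable11 s l -> coef11 t s l = 0.
Proof. by rewrite negb_or -lt0n -leqNgt => /andP[s0 sl]; apply: coef11_1. Qed.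

Lemma pick_partition (V : lmodType R) n (G : intpart -> V) la c : weight la = n ->
  \sum_(nu <- partitions n) ((nu == la)%:R * c) *: G nu = c *: G la.
Proof.
move=> /eqP; rewrite -mem_partitions => lan.
rewrite (bigD1_seq la) ?partitions_uniq //= eqxx mul1r big1 ?addr0 // => nu /negPf->.
by rewrite mul0r scale0r.
Qed.

(** Passing to the signed functions multiplies a coefficient by (-1)^(n(mu) + n(la)): this turns
    t^(m_(s+1)) into (-t)^(m_(s+1)) in the first family and cancels the minus sign of the second. *)
Lemma sum_xi_val (V : lmodType R) (q : intpart -> V) mu :
  \sum_(la <- partitions (weight mu + 2)) xi_val mu la *: ((-1) ^+ nstat la *: q la) =
  (-1) ^+ nstat mu *: (\sum_(s < (weight mu).+1) coef2 t s mu *: q (up2p s mu) -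
                       \sum_(s < (weight mu).+1) coef11 t s mu *: q (up11p s mu)).
Proof.
have /andP[_ l0] := intpart_is_intpart mu.
rewrite scalerBr !scaler_sumr -sumrN.
under eq_bigr => la _ do rewrite /xi_val big_split scalerDl !scaler_suml.
rewrite big_split; congr (_ + _); rewrite exchange_big; apply: eq_bigr => s _ /=.
  have [ad|nad] := boolP (addable2 s mu); last first.
    rewrite coef2_eq0 // scale0r scaler0 big1 // => la _.
    by rewrite xi2_eq0 // mulr0 scale0r.
  rewrite pick_partition; last exact: sumn_up2.
  rewrite !scalerA; congr (_ *: _).
  have -> : xi2 mu s = (-1) ^+ nstat mu * (-1) ^+ nstat (up2p s mu) * coef2 t s mu.
    by rewrite sign_up2p // /xi2 /coef2 [(- t) ^+ _]exprNn -/(mpart mu s.+1) !mulrA.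
  pose e : R := (-1) ^+ nstat (up2p s mu).
  by rewrite mulrAC -(mulrA _ e e) -expr2 sqrr_sign mulr1.
have [ad|nad] := boolP (addable11 s mu); last first.
  rewrite coef11_eq0 // scale0r scaler0 oppr0 big1 // => la _.
  by rewrite mulr0 scale0r.
rewrite pick_partition; last exact: sumn_up11.
rewrite !scalerA -scaleNr; congr (_ *: _).
suff -> : (-1) ^+ nstat (up11p s mu) = - (-1) ^+ nstat mu :> R by rewrite mulrN mulrC.
have s0 : (-1) ^+ nstat mu != 0 :> R by rewrite signr_eq0.
by apply: (mulfI s0); rewrite sign_up11p // mulrN -expr2 sqrr_sign.
Qed.

Lemma p2_expansionE mu xi : p2_expansion t mu xi <->
  ((1 - t ^+ 2) *: psum R 2) * HL_Qt t mu =
  \sum_(la <- partitions (weight mu + 2)) xi la *: HL_Qt t la.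
Proof. by rewrite /p2_expansion fsbig_finite //; apply: finite_weight. Qed.

Lemma xi_val_expansion mu : p2_expansion t mu (xi_val mu).
Proof.
apply/p2_expansionE; rewrite [RHS]sum_xi_val -psum2_HL_Q.
by rewrite {1}/HL_Qt; apply/esym/scalerAr.
Qed.

Lemma sum_scale_diff0 (V : lmodType R) (q : intpart -> V) (c xi xi' : intpart -> R) s :
  \sum_(la <- s) xi la *: (c la *: q la) = \sum_(la <- s) xi' la *: (c la *: q la) ->
  \sum_(la <- s) ((xi la - xi' la) * c la) *: q la = 0.
Proof.
move=> e; under eq_bigr => la _ do rewrite -scalerA scalerBl.
by rewrite sumrB e subrr.
Qed.

Lemma p2_expansion_uniq mu xi xi' : p2_expansion t mu xi -> p2_expansion t mu xi' ->
  forall la, weight la = (weight mu + 2)%N -> xi la = xi' la.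
Proof.
move=> /p2_expansionE e /p2_expansionE e' la law; rewrite e in e'.
apply/eqP; rewrite -subr_eq0; apply/eqP.
have s0 : (-1) ^+ nstat la != 0 :> R by rewrite signr_eq0.
apply: (mulIf s0); rewrite mul0r.
apply: (@HL_Q_free R t t_bnd (weight mu + 2)%N
  (fun nu => (xi nu - xi' nu) * (-1) ^+ nstat nu)) law.
exact: sum_scale_diff0 e'.
Qed.

End Expansion.

Theorem theorem8p6 (R : realType) (t : R) (ht : -1 < t < 0) (mu : intpart) :
  (exists xi : intpart -> R, p2_expansion t mu xi) /\
  forall xi : intpart -> R, p2_expansion t mu xi ->
  forall la : intpart, weight la = (weight mu + 2)%N ->
    (~ two_box_arrow mu la -> xi la = 0) /\
    (two_box_arrow mu la ->
      (forall k : nat, in_single_column la mu k ->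
         xi la = (1 - pow_ext t (mult_ext mu k.-1)) *
                 (1 - pow_ext t (omap predn (mult_ext mu k.-1)))) /\
      (forall k : nat, in_two_columns la mu k ->
         xi la = (- t) ^+ mpart mu k * (1 + t) *
                 (1 - pow_ext t (mult_ext mu k.-1)))).
Proof.
split; first by exists (xi_val t mu); apply: xi_val_expansion.
move=> xi hxi la law.
rewrite (p2_expansion_uniq ht hxi (xi_val_expansion ht mu) law).
have term2_neq0 s : (la == up2p s mu)%:R * xi2 t mu s != 0 -> addable2 s mu /\ la = up2p s mu.
  have [->|_] := eqVneq la (up2p s mu); last by rewrite mul0r eqxx.
  by have [//|nad] := boolP (addable2 s mu); rewrite xi2_eq0 // mulr0 eqxx.
have term11_neq0 s : (la == up11p s mu)%:R * coef11 t s mu != 0 ->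
    addable11 s mu /\ la = up11p s mu.
  have [->|_] := eqVneq la (up11p s mu); last by rewrite mul0r eqxx.
  by have [//|nad] := boolP (addable11 s mu); rewrite coef11_eq0 // mulr0 eqxx.
have memW s : s \in parts mu -> (s < (weight mu).+1)%N by move/leq_sumn; rewrite ltnS.
split=> [narr|[_ sub _]].
  rewrite /xi_val big1 // => s _.
  have [->|/term2_neq0[ad e]] := eqVneq ((la == up2p s mu)%:R * xi2 t mu s) 0; last first.
    by case: narr; rewrite e; case: (up2p_arrow ad).
  have [->|/term11_neq0[ad e]] := eqVneq ((la == up11p s mu)%:R * coef11 t s mu) 0; last first.
    by case: narr; rewrite e; case: (up11p_arrow ad).
  by rewrite addr0.
split=> k sk.
  have [k0 [ad e]] := single_up11p law sub sk.
  have kW : (k.-1 < (weight mu).+1)%N.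
    by case/orP: ad => [/eqP->//|/count_mem_gt1[/memW]].
  have t2 s : (la == up2p s mu)%:R * xi2 t mu s = 0.
    have [//|/term2_neq0[ad2 e2]] := eqVneq ((la == up2p s mu)%:R * xi2 t mu s) 0.
    have [_ two] := up2p_arrow ad2; rewrite -e2 in two.
    by case: (two_not_single two sk).
  rewrite /xi_val (bigD1 (Ordinal kW)) //= t2 add0r big1 ?addr0.
    (* For k = 1 both powers are 0 on either side. For k > 1 the truncated predecessor is harmless,
       as [ad] gives at least two parts k - 1. *)
    rewrite -e eqxx mul1r /coef11 /tmult /tmult1 /mult_ext.
    by case: (k.-1 == 0%N).
  move=> s sk'; rewrite t2 add0r.
  have [//|/term11_neq0[ad1 e1]] := eqVneq ((la == up11p s mu)%:R * coef11 t s mu) 0.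
  have [_ one] := up11p_arrow ad1; rewrite -e1 in one.
  (* The column number determines s, so a single term of the sum remains. *)
  by case/eqP: sk'; apply: val_inj; rewrite /= -(single_inj one sk).
have [k0 [ad e]] := two_up2p law sub sk.
have kW : (k.-1 < (weight mu).+1)%N by case/orP: ad => [/eqP->//|/memW].
have t1 s : (la == up11p s mu)%:R * coef11 t s mu = 0.
  have [//|/term11_neq0[ad2 e2]] := eqVneq ((la == up11p s mu)%:R * coef11 t s mu) 0.
  have [_ one] := up11p_arrow ad2; rewrite -e2 in one.
  by case: (two_not_single sk one).
rewrite /xi_val (bigD1 (Ordinal kW)) //= t1 addr0 big1 ?addr0.
  rewrite -e eqxx mul1r /xi2 /tmult /mult_ext prednK //.
  by case: (k.-1 == 0%N).
move=> s sk'; rewrite t1 addr0.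
have [//|/term2_neq0[ad1 e1]] := eqVneq ((la == up2p s mu)%:R * xi2 t mu s) 0.
have [_ two] := up2p_arrow ad1; rewrite -e1 in two.
by case/eqP: sk'; apply: val_inj; rewrite /= -(two_inj two sk).
Qed.
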